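(* The identity $$-\log\Bigl(1-\sum_{i=0}^\infty x_i\Bigr) = -\sum_{\mathbf{n}\in\mathbb{N}^{\mathbb{N}}_0-\{\mathbf{0}\}} c_{\mathbf{n}}\log(1-\mathbf{x}^{\mathbf{n}})$$ converges absolutely uniformly in the region cut out by $$\sum_{i=0}^\infty|x_i|<1-\epsilon$$ for any choice of $\epsilon>0$, where the coefficients $c_{\mathbf{n}}$ are given by the following equivalent formulas: (i) $$c_{\mathbf{n}}=\frac{1}{|\mathbf{n}|}\sum_{d\mid\gcd(\mathbf{n})}\mu(d)\binom{|\mathbf{n}/d|}{\mathbf{n}/d};$$ (ii) $c_{\mathbf{n}}$ equals the number of orbits of length $|\mathbf{n}|$ in $$\mathcal{P}_{\mathbf{n}}(\mathbb{Z}/|\mathbf{n}|\mathbb{Z})=\{(A_0,A_1,A_2,\dots): A_i\subseteq\mathbb{Z}/|\mathbf{n}|\mathbb{Z},\ |A_i|=n_i,\ A_i\cap A_j=\emptyset\text{ when }i\neq j\}$$ under the action of $\mathbb{Z}/|\mathbf{n}|\mathbb{Z}$ defined by $1.(A_0,A_1,\dots)=(\{a+1:a\in A_0\},\{a+1:a\in A_1\},\dots)$. In particular, (ii) implies $c_{\mathbf{n}}\in\mathbb{N}$.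
   Context: $\mathbb{N}=\{0,1,2,\dots\}$ and $x_0,x_1,x_2,\dots$ are countably many complex variables; formally the identity takes place in the power series ring $\mathbb{C}[[x_0,x_1,x_2,\dots]]$. For $\mathbf{n}=(n_0,n_1,\dots)\in\mathbb{N}^{\mathbb{N}}$, $|\mathbf{n}|=\sum_i n_i$; $\mathbb{N}^{\mathbb{N}}_0$ is the set of $\mathbf{n}$ with $|\mathbf{n}|<\infty$, and $\mathbf{0}$ is the zero sequence. For $\mathbf{n}\in\mathbb{N}^{\mathbb{N}}_0$, $\mathbf{x}^{\mathbf{n}}=\prod_i x_i^{n_i}$, $\gcd(\mathbf{n})=\gcd(n_0,n_1,\dots)$, $\mathbf{n}/d=(n_0/d,n_1/d,\dots)$, and $\binom{|\mathbf{n}|}{\mathbf{n}}=|\mathbf{n}|!/\prod_i n_i!$ is the multinomial coefficient. $\mu$ is the Möbius function. $\log(1-w)$ is given by the Taylor series $-\sum_{k\ge1}w^k/k$.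
   Formalization: Uniform convergence over finite sets of n fails on the region when 0<ε<1 (take x with one nonzero entry far out). Proved: absolute convergence there, uniform when summed by degree |n|, and uniform over finite sets of n on subsets where Σ|x_i| converges uniformly. *)

(* Defs.v *)
From HB Require Import structures.
From mathcomp Require Import all_boot all_order all_algebra.
From mathcomp Require Import finmap.
From mathcomp Require Import all_classical all_reals all_analysis.
From mathcomp Require Import complex.
From mathcomp.analysis.showcase Require Import summability.
(* The notations of monalg clash with those of MathComp-Analysis. *)
From mathcomp Require Import -(notations) monalg.

Set Implicit Arguments.
Unset Strict Implicit.
Unset Printing Implicit Defensive.

Import Order.TTheory GRing.Theory Num.Theory.
Import numFieldNormedType.Exports.
Import ComplexField.Normc.

Local Open Scope classical_set_scope.
Local Open Scope ring_scope.

(* Finitely supported sequences n : nat -> nat are the commutative monomials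
   [cmonom nat] of monalg: [mdeg n] is |n|, [mone] is the zero sequence, [ucm i]
   is the i-th unit sequence, and [mmul] is the pointwise sum. *)

Definition nonzero_exponents : set (cmonom nat) := [set n | n != mone].

Definition mgcd (n : cmonom nat) : nat := \big[gcdn/0%N]_(i <- finsupp n) n i.

Definition mquo (n : cmonom nat) (d : nat) : cmonom nat :=
  CMonom [fsfun i in finsupp n => (n i %/ d)%N | 0%N].

Definition multinomial (n : cmonom nat) : rat :=
  (mdeg n)`!%:R / (\prod_(i <- finsupp n) (n i)`!)%N%:R.

Definition mobius (d : nat) : int :=
  if (0 < d)%N && all (fun p => logn p d == 1%N) (primes d)
  then (-1) ^+ size (primes d) else 0.

Definition coef (n : cmonom nat) : rat :=
  (mdeg n)%:R^-1 *
  \sum_(d <- divisors (mgcd n)) (mobius d)%:~R * multinomial (mquo n d).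

(* Z/|n|Z is represented by ['I_(mdeg n)] with the cyclic successor [ordS];
   ['Z_(mdeg n)] would be wrong for |n| = 1. *)
Definition configurations (n : cmonom nat) : set (nat -> {set 'I_(mdeg n)}) :=
  [set A : nat -> {set 'I_(mdeg n)} |
    (forall i, #|A i| = n i) /\
    (forall i j, i <> j -> A i :&: A j = finset.set0)%SET].

Arguments configurations : clear implicits.

Definition translate (m : nat) (A : nat -> {set 'I_m}) : nat -> {set 'I_m} :=
  fun i => (@ordS m @: A i)%SET.

Definition zmod_orbit (m : nat) (A : nat -> {set 'I_m}) :
    set (nat -> {set 'I_m}) :=
  range (fun k : 'I_m => iter k (@translate m) A).

Definition full_orbits (n : cmonom nat) :
    set (set (nat -> {set 'I_(mdeg n)})) :=
  [set O | (@zmod_orbit _ @` configurations n) O /\ (O #= `I_(mdeg n))%card].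

Arguments full_orbits : clear implicits.

(* Power series in x_0, x_1, ... over K, given by their coefficients.  Infinite
   sums are taken coefficientwise; [fps_summable] says that every coefficient
   involves finitely many terms, without which [fps_sum] is meaningless. *)
Definition fps (K : fieldType) := cmonom nat -> K.

Definition fps_mono (K : fieldType) (n : cmonom nat) : fps K :=
  fun m => (m == n)%:R.

Definition fps_mul (K : fieldType) (f g : fps K) : fps K :=
  fun m => \sum_(p \in [set p : cmonom nat * cmonom nat | mmul p.1 p.2 = m])
             f p.1 * g p.2.

Definition fps_pow (K : fieldType) (f : fps K) (k : nat) : fps K :=
  iter k (fps_mul f) (fps_mono K mone).

Definition fps_summable (K : fieldType) (I : choiceType) (D : set I)
    (f : I -> fps K) : Prop :=
  forall m, finite_set (D `&` [set i | f i m != 0]).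

Definition fps_sum (K : fieldType) (I : choiceType) (D : set I)
    (f : I -> fps K) : fps K :=
  fun m => \sum_(i \in D) f i m.

(* log (1 - w), for w without constant term. *)
Definition fps_log1m (K : fieldType) (w : fps K) : fps K :=
  fun m => - fps_sum [set k | (0 < k)%N] (fun k m => fps_pow w k m / k%:R) m.

Definition fps_var_sum (K : fieldType) : fps K :=
  fps_sum [set: nat] (fun i => fps_mono K (ucm i)).

(* log (1 - w), for |w| < 1. *)
Definition log1m (K : numFieldType) (w : K) : K :=
  - limn (series (fun k => w ^+ k.+1 / k.+1%:R)).

(* The family (f i), i in D, is unconditionally summable with sum s. *)
Definition has_sum (K : numFieldType) (I : choiceType) (D : set I)
    (f : I -> K) (s : K) : Prop :=
  (fun F : {fset I} => \sum_(i <- F | i \in D) f i) @ totally --> s.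

Definition series_sum (K : numFieldType) (u : nat -> K) : K := limn (series u).

Definition eval_mono (K : fieldType) (x : nat -> K) (n : cmonom nat) : K :=
  \prod_(i <- finsupp n) x i ^+ n i.

Definition fps_term (R : realType) (n : cmonom nat) : fps R[i] :=
  fun m => ratr (coef n) * fps_log1m (fps_mono R[i] n) m.

Definition term (R : realType) (x : nat -> R[i]) (n : cmonom nat) : R[i] :=
  ratr (coef n) * log1m (eval_mono x n).

Definition region (R : realType) (e : R) : set (nat -> R[i]) :=
  [set x | (\sum_(0 <= i <oo) (normc (x i))%:E < (1 - e)%:E)%E].

Definition abs_cvg (R : realType) (I : choiceType) (D : set I)
    (f : I -> R[i]) : Prop :=
  (\esum_(i in D) (normc (f i))%:E < +oo)%E.

(* Absolute uniform convergence on S over the directed set of finite sets of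
   indices. *)
Definition abs_unif_cvg (R : realType) (I : choiceType) (T : Type) (D : set I)
    (S : set T) (f : T -> I -> R[i]) : Prop :=
  forall d : R, 0 < d -> exists F : {fset I}, forall x, S x ->
    (\esum_(i in D `\` [set i | i \in F]) (normc (f x i))%:E <= d%:E)%E.

(* Absolute uniform convergence on S of the sum by increasing degree, as for the
   expansion of a function of infinitely many variables in homogeneous parts.
   This is weaker than [abs_unif_cvg], which fails on [region e] (0 < e < 1)
   even for the series of the coordinates x_i: at the sequence with the single
   nonzero entry x_i = r, 0 < r < 1 - e, a finite partial sum not involving x_i
   is 0. *)
Definition abs_unif_cvg_deg (R : realType) (I : choiceType) (T : Type)
    (deg : I -> nat) (D : set I) (S : set T) (f : T -> I -> R[i]) : Prop :=
  forall d : R, 0 < d -> exists N : nat, forall x, S x ->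
    (\esum_(i in D `&` [set i | (N <= deg i)%N]) (normc (f x i))%:E <= d%:E)%E.

(* Main.v *)
Require Import Defs.
From HB Require Import structures.
From mathcomp Require Import all_boot all_order all_algebra.
From mathcomp Require Import finmap.
From mathcomp Require Import all_classical all_reals all_analysis.
From mathcomp Require Import complex.
From mathcomp.analysis.showcase Require Import summability.
From mathcomp Require Import -(notations) monalg.
From mathcomp Require Import ring lra.
Import Order.TTheory GRing.Theory Num.Theory.
Import numFieldNormedType.Exports.
Import ComplexField.Normc.
Local Open Scope classical_set_scope.
Local Open Scope ring_scope.
Set Implicit Arguments.
Unset Strict Implicit.

(** Expanding every logarithm on the right, the coefficient of [x^m] is the sum
    over the divisors [k] of [gcd(m)] of [c_(m/k) / k], because [x^m] occurs in
    [log(1 - x^n)] exactly when [m] is a multiple [kn].  The definition of [c]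
    as a Moebius sum is made so that this equals [binom(|m|, m) / |m|]
    ([sum_coef]).  On the left, [binom(|m|, m)] is the coefficient of [x^m] in
    the [|m|]-th power of the sum of the variables ([multinomial_rec] compares
    the two by removing one variable), so both sides have the same coefficients.

    A configuration is a word of length [|n|] in which the letter [i]
    occurs [n_i] times, and the cyclic action is rotation.  A word fixed by the
    rotation by [|n|/d] is a [d]-th power, so there are [binom(|n/d|, n/d)] of
    them ([count_fixed_words]).  Hence the Moebius sum over [d] counts the words
    with trivial stabilizer ([card_primitive]), which split into orbits of
    length [|n|].

    For convergence, let [rho] be the sum of the [|x_i|], [rho < 1 - e].  From
    [sum_coef] and [c_n >= 0], [c_n <= binom(|n|, n)], and
    [|log(1 - w)| <= |w| / (1 - |w|)], so the term of index [n] is at most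
    [binom(|n|, n) |x|^n / e].  These majorants add up to [rho^d] in degree [d]
    ([esum_weight_deg]), so the tail from degree [N] on is at most
    [(1 - e)^N / e]: this is absolute convergence, uniform by degree.  If the
    series of the coordinates converges uniformly, a finite set [F] of
    variables carries all but a small part of [rho], and the monomials involving
    other variables contribute only [1/(1 - rho) - 1/(1 - rho_F)]
    ([esum_weight_outside]); together with the degree bound, a finite set of
    monomials suffices.

    The value of the sum comes from the doubly indexed family
    [c_n x^(kn) / k].  It is absolutely summable, and an unconditional sum may
    be computed by fibres of any map ([has_sum_fibers]): grouping by [n] gives
    the right-hand side, grouping by the monomial [x^(kn)] and then by degree
    gives the expansion of [- log(1 - sum x_i)]. *)

(** * The Moebius function *)

Lemma mobiusE d : (0 < d)%N -> mobius d =
  if all (fun p => logn p d == 1%N) (primes d) then (-1) ^+ size (primes d) else 0.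
Proof. by rewrite /mobius => ->. Qed.

Lemma mobius_mul_dvd p d : prime p -> (0 < d)%N -> (p %| d)%N -> mobius (p * d)%N = 0.
Proof.
move=> pp d0 pd; have pd0 : (0 < p * d)%N by rewrite muln_gt0 prime_gt0.
rewrite mobiusE//; case: allP => // /(_ p).
rewrite mem_primes pp pd0 dvdn_mulr// => /(_ isT).
rewrite lognM ?(prime_gt0 pp)//; rewrite logn_prime// eqxx.
by have := pfactor_dvdn 1 pp d0; rewrite expn1 pd; case: (logn p d).
Qed.

Lemma mobius_mul_coprime p d : prime p -> (0 < d)%N -> ~~ (p %| d)%N ->
  mobius (p * d)%N = - mobius d.
Proof.
move=> pp d0 pd; have pd0 : (0 < p * d)%N by rewrite muln_gt0 prime_gt0.
have Pp : perm_eq (primes (p * d)%N) (p :: primes d).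
  apply: uniq_perm; rewrite /= ?primes_uniq ?andbT//.
    by rewrite mem_primes pp d0.
  by move=> q; rewrite primesM ?(prime_gt0 pp)// primes_prime// mem_seq1 in_cons.
rewrite !mobiusE// (perm_all _ Pp) (perm_size Pp) /=.
rewrite lognM ?(prime_gt0 pp)//; rewrite logn_prime// eqxx.
have -> : logn p d = 0%N.
  by apply/eqP; have := pfactor_dvdn 1 pp d0; rewrite expn1 (negPf pd); case: (logn p d).
rewrite exprS mulN1r /= -[LHS]/(if _ then _ else _).
have -> : all (fun q => logn q (p * d)%N == 1%N) (primes d)
        = all (fun q => logn q d == 1%N) (primes d).
  apply: eq_in_all => q; rewrite mem_primes => /and3P[pq _ qd].
  rewrite lognM ?(prime_gt0 pp)// logn_prime//.
  by rewrite (negPf (_ : q != p))//; apply: contraNneq pd => <-.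
by case: ifP; rewrite ?oppr0.
Qed.

(** For a prime [p] dividing [n], the divisors [d] and [p * d] cancel when [p]
    does not divide [d], and [mobius (p * d) = 0] otherwise. *)
Lemma sum_mobius n : (0 < n)%N ->
  \sum_(d <- divisors n) mobius d = (n == 1%N)%:R :> int.
Proof.
move=> n0; case: eqVneq => [->|n1].
  by rewrite big_seq1 mobiusE.
pose p := pdiv n; have pp : prime p by rewrite pdiv_prime// ltn_neqAle eq_sym n1.
have pn : (p %| n)%N := pdiv_dvd n.
rewrite (bigID (fun d => p %| d)%N) /=.
have -> : \sum_(d <- divisors n | (p %| d)%N) mobius d =
          \sum_(d <- [seq (p * d)%N | d <- divisors (n %/ p)]) mobius d.
  rewrite -big_filter; apply: perm_big; apply: uniq_perm.
  - by rewrite filter_uniq ?divisors_uniq.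
  - rewrite map_inj_uniq ?divisors_uniq// => x y /eqP.
    by rewrite eqn_pmul2l ?prime_gt0// => /eqP.
  move=> d; rewrite mem_filter -dvdn_divisors//.
  apply/andP/mapP => [[pd dn]|[e]].
    exists (d %/ p)%N; last by rewrite mulnC divnK.
    rewrite -dvdn_divisors; last by rewrite divn_gt0 ?prime_gt0// dvdn_leq.
    by rewrite dvdn_divRL// divnK.
  rewrite -dvdn_divisors; last by rewrite divn_gt0 ?prime_gt0// dvdn_leq.
  by move=> en ->; rewrite dvdn_mulr// mulnC -dvdn_divRL.
have np0 : (0 < n %/ p)%N by rewrite divn_gt0 ?prime_gt0// dvdn_leq.
rewrite big_map (bigID (fun d => p %| d)%N) /= big1_seq; last first.
  move=> d /andP[pd]; rewrite -dvdn_divisors// => dn.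
  by rewrite mobius_mul_dvd// (dvdn_gt0 np0 dn).
rewrite add0r big_seq_cond (eq_bigr (fun d => - mobius d)); last first.
  move=> d /andP[]; rewrite -dvdn_divisors// => dn pd.
  by rewrite mobius_mul_coprime// (dvdn_gt0 np0 dn).
rewrite -big_seq_cond sumrN -[X in - X]big_filter -[X in _ + X]big_filter.
rewrite (perm_big [seq d <- divisors n | ~~ (p %| d)%N]) ?addNr//=.
apply: uniq_perm; rewrite ?filter_uniq ?divisors_uniq// => d.
rewrite !mem_filter -!dvdn_divisors//; case: (boolP (p %| d)%N) => //= pd.
apply/idP/idP => dn; first by rewrite -(divnK pn) dvdn_mulr.
by rewrite -(@Gauss_dvdr _ p) ?[(p * _)%N]mulnC ?divnK// coprime_sym prime_coprime.
Qed.

(** * Multinomial coefficients as numbers of words *)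

Lemma cmonomP (m n : cmonom nat) : (forall i, m i = n i) -> m = n.
Proof. by move=> mn; apply/eqP/cmP. Qed.

Lemma cmonom_mulK (m : cmonom nat) i : i \in finsupp m ->
  mmul (ucm i) (divcm m (ucm i)) = m.
Proof.
rewrite -cmE_neq0 => mi; apply: cmonomP => j; rewrite cmM divcmE subnKC//.
by rewrite cmU; case: eqVneq => // <-; rewrite lt0n.
Qed.

Lemma mdeg_div_ucm (m : cmonom nat) i : i \in finsupp m ->
  mdeg m = (mdeg (divcm m (ucm i))).+1.
Proof. by move=> im; rewrite -[in LHS](cmonom_mulK im) mdegM mdegU. Qed.

Lemma mdeg1_ucm (m : cmonom nat) : mdeg m = 1%N -> exists i, m = ucm i.
Proof.
move=> d1; have [i im] : exists i, i \in finsupp m.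
  apply: contrapT => H; suff m1 : m = mone by rewrite m1 mdeg1 in d1.
  apply: cmonomP => i; rewrite cm1; apply/eqP; rewrite cmE_eq0.
  by apply/negP => im; apply: H; exists i.
exists i; rewrite -(cmonom_mulK im) [divcm _ _](_ : _ = mone) ?mulm1//.
by apply/mdeg_eq0I/succn_inj; rewrite -mdeg_div_ucm.
Qed.

Lemma multinomialEw (m : cmonom nat) (d : {fset nat}) :
  (finsupp m `<=` d)%fset ->
  multinomial m = (mdeg m)`!%:R / (\prod_(i <- d) (m i)`!)%N%:R.
Proof.
move=> md; congr (_ / _%:R); apply: big_fset_incl => // i _.
by rewrite memNfinsupp => /eqP ->.
Qed.

Lemma fact_prod_neq0 (m : cmonom nat) (d : {fset nat}) :
  ((\prod_(i <- d) (m i)`!)%N)%:R != 0 :> rat.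
Proof.
by rewrite pnatr_eq0 -lt0n prodn_gt0// => i; rewrite fact_gt0.
Qed.

Lemma multinomial_div_ucm (m : cmonom nat) i : i \in finsupp m ->
  multinomial (divcm m (ucm i)) = multinomial m * (m i)%:R / (mdeg m)%:R.
Proof.
move=> im; have mi : (m i != 0)%N by rewrite cmE_neq0.
have sub : (finsupp (divcm m (ucm i)) `<=` finsupp m)%fset.
  apply/fsubsetP => j; rewrite -!cmE_neq0 divcmE; apply: contraNneq => ->.
  by rewrite sub0n.
rewrite (multinomialEw sub) /multinomial (mdeg_div_ucm im) factS.
rewrite !(big_fsetD1 i im) /=.
have -> : (\prod_(j <- (finsupp m `\ i)%fset) (divcm m (ucm i) j)`!)%N =
          (\prod_(j <- (finsupp m `\ i)%fset) (m j)`!)%N.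
  rewrite !big_seq; apply: eq_bigr => j; rewrite !inE => /andP[ji _].
  by rewrite divcmE cmU eq_sym (negPf ji) subn0.
rewrite divcmE cmUU subn1; case: (m i) mi => // k _ /=.
rewrite factS !natrM !invfM.
have := fact_prod_neq0 m (finsupp m `\ i)%fset.
set P := (X in X != 0); move=> P0.
have k1 : k.+1%:R != 0 :> rat by rewrite pnatr_eq0.
have d1 : (mdeg (divcm m (ucm i))).+1%:R != 0 :> rat by rewrite pnatr_eq0.
have k2 : (k`!)%:R != 0 :> rat by rewrite pnatr_eq0 -lt0n fact_gt0.
move: k1 d1 k2 P0; rewrite -/P.
move: P (k.+1%:R : rat) (k`!%:R : rat) ((mdeg _).+1%:R : rat).
by move=> P K L D K0 D0 L0 P0; field; rewrite P0 K0 L0 D0.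
Qed.

(** Removing one [i] multiplies the multinomial coefficient by [m i / mdeg m],
    and these fractions add up to 1.  The same recursion sorts words by their
    first letter and powers of the sum of the variables by their first factor. *)
Lemma multinomial_rec (m : cmonom nat) : m != mone ->
  multinomial m = \sum_(i <- finsupp m) multinomial (divcm m (ucm i)).
Proof.
move=> m1; rewrite big_seq (eq_bigr _ (fun i => @multinomial_div_ucm m i)).
rewrite -big_seq -mulr_suml -mulr_sumr -natr_sum -mdegE mulfK//.
by rewrite pnatr_eq0 mdeg_eq0.
Qed.

Lemma multinomial1 : multinomial mone = 1.
Proof. by rewrite /multinomial mdom1 big_seq_fset0 mdeg1 divr1. Qed.

Definition mword (m : cmonom nat) : seq nat :=
  flatten [seq nseq (m i) i | i <- finsupp m].

Lemma count_mword m i : count_mem i (mword m) = m i.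
Proof.
rewrite /mword count_flatten -map_comp sumnE big_map /=.
rewrite (eq_bigr (fun j => if j == i then m j else 0%N)) => [|j _]; last first.
  by rewrite /= count_nseq /=; case: eqP; rewrite ?mul1n.
rewrite -big_mkcond/= -big_filter; case: (boolP (i \in finsupp m)) => [im|].
  rewrite (perm_big [:: i]) ?big_seq1//.
  apply: uniq_perm; rewrite ?filter_uniq ?fset_uniq// => j.
  by rewrite mem_filter inE; case: eqP => // ->.
rewrite memNfinsupp => /eqP mi0; rewrite big_filter big1// => j /eqP ->//.
Qed.

Lemma size_mword m : size (mword m) = mdeg m.
Proof.
rewrite /mword size_flatten /shape -map_comp sumnE big_map.
by apply: eq_bigr => i _; rewrite /= size_nseq.
Qed.

Lemma mem_mword m i : (i \in mword m) = (i \in finsupp m).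
Proof. by rewrite -has_pred1 has_count count_mword -cmE_neq0 lt0n. Qed.

Definition words m := permutations (mword m).

Lemma mem_words (m : cmonom nat) (w : seq nat) :
  reflect (forall i, count_mem i w = m i) (w \in words m).
Proof.
rewrite mem_permutations; apply: (iffP idP) => [/permP wm i|wm].
  by rewrite wm count_mword.
by apply/allP => i _ /=; rewrite wm count_mword.
Qed.

Lemma size_word (m : cmonom nat) w : w \in words m -> size w = mdeg m.
Proof. by rewrite mem_permutations => /perm_size ->; rewrite size_mword. Qed.

(** The recursion by the first letter is [multinomial_rec]. *)
Lemma size_words m : (size (words m))%:R = multinomial m.
Proof.
have [k] := ubnP (mdeg m); elim: k m => // k IH m mk.
have [->|m1] := eqVneq m mone.
  rewrite multinomial1 /words /mword mdom1 /=; first by [].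
rewrite multinomial_rec// /words (perm_size (permutationsE _)); last first.
  by rewrite size_mword lt0n mdeg_eq0.
rewrite size_allpairs_dep sumnE big_map natr_sum.
rewrite (perm_big (finsupp m)) /=; last first.
  apply: uniq_perm; rewrite ?undup_uniq// => i.
  by rewrite mem_undup mem_mword.
rewrite !big_seq; apply: eq_bigr => i im.
rewrite -IH; last by rewrite (mdeg_div_ucm im) ltnS in mk.
congr (_%:R); apply/perm_size/perm_permutations/allP => j _ /=.
by rewrite count_mword count_rem mem_mword im count_mword divcmE cmU.
Qed.

(** * Powers and roots of monomials *)

Definition mpow (n : cmonom nat) k := iter k (mmul n) mone.

Lemma mpowE n k i : mpow n k i = (k * n i)%N.
Proof.
by elim: k => [|k IH]; rewrite /= ?cm1// cmM IH mulSn.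
Qed.

Lemma mdeg_mpow n k : mdeg (mpow n k) = (k * mdeg n)%N.
Proof.
by elim: k => [|k IH]; rewrite /= ?mdeg1// mdegM IH mulSn.
Qed.

Lemma mquoE m d i : mquo m d i = (m i %/ d)%N.
Proof.
rewrite fsfun_fun; case: ifP => // /negbT; rewrite memNfinsupp => /eqP ->.
by rewrite div0n.
Qed.

Lemma dvd_mgcdP d (m : cmonom nat) : reflect (forall i, d %| m i)%N (d %| mgcd m)%N.
Proof.
rewrite /mgcd; apply: (iffP idP) => [dg i|dm].
  have [im|] := boolP (i \in finsupp m); last by rewrite memNfinsupp => /eqP ->.
  by move: dg; rewrite (big_fsetD1 i)//= dvdn_gcd => /andP[].
by elim/big_ind: _ => // x y dx dy; rewrite dvdn_gcd dx.
Qed.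

Lemma cmonom_neq1P (m : cmonom nat) : m != mone -> exists i, (0 < m i)%N.
Proof.
move=> m1; apply: contrapT => H; move/eqP: m1; apply; apply: cmonomP => i.
by rewrite cm1; case E : (m i) => [//|k]; case: H; exists i; rewrite E.
Qed.

Lemma mgcd_gt0 m : m != mone -> (0 < mgcd m)%N.
Proof.
move=> /cmonom_neq1P[i mi]; rewrite lt0n; apply/eqP => g0.
have /dvd_mgcdP/(_ i) : (0 %| mgcd m)%N by rewrite g0.
by rewrite dvd0n; case: (m i) mi.
Qed.

Lemma mpow_mquo m k : (k %| mgcd m)%N -> mpow (mquo m k) k = m.
Proof.
by move=> /dvd_mgcdP km; apply: cmonomP => i; rewrite mpowE mquoE mulnC divnK.
Qed.

Lemma mquo_mpow n k : (0 < k)%N -> mquo (mpow n k) k = n.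
Proof. by move=> k0; apply: cmonomP => i; rewrite mquoE mpowE mulKn. Qed.

Lemma dvd_mgcd_mpow n k : (k %| mgcd (mpow n k))%N.
Proof. by apply/dvd_mgcdP => i; rewrite mpowE dvdn_mulr. Qed.

Lemma mpow_inj n : n != mone -> injective (mpow n).
Proof.
move=> /cmonom_neq1P[i ni] k l /(congr1 (fun m : cmonom nat => m i)).
by rewrite !mpowE => /eqP; rewrite eqn_pmul2r// => /eqP.
Qed.

Lemma mpow_eq1 n k : n != mone -> (0 < k)%N -> mpow n k != mone.
Proof. by rewrite -!mdeg_eq0 mdeg_mpow -!lt0n muln_gt0 => -> ->. Qed.

Lemma mdeg_mquo m k : (k %| mgcd m)%N -> (k * mdeg (mquo m k))%N = mdeg m.
Proof. by move=> km; rewrite -mdeg_mpow mpow_mquo. Qed.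

Lemma mquo_mquo m k d : mquo (mquo m k) d = mquo m (k * d).
Proof. by apply: cmonomP => i; rewrite !mquoE divnMA. Qed.

Lemma mgcd_mquo m k : m != mone -> (k %| mgcd m)%N ->
  mgcd (mquo m k) = (mgcd m %/ k)%N.
Proof.
move=> m1 km; have k0 := dvdn_gt0 (mgcd_gt0 m1) km.
have H d : (d %| mgcd (mquo m k))%N = (d %| mgcd m %/ k)%N.
  rewrite dvdn_divRL//.
  apply/dvd_mgcdP/dvd_mgcdP => dm i; have := dm i; rewrite mquoE dvdn_divRL//;
    exact/dvd_mgcdP.
by apply/eqP; rewrite eqn_dvd H dvdnn -H dvdnn.
Qed.

Lemma mquo_neq1 m k : m != mone -> (k %| mgcd m)%N -> mquo m k != mone.
Proof.
move=> m1 km; apply: contraNneq m1 => q1; rewrite -(mpow_mquo km) q1.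
by apply/eqP/cmonomP => i; rewrite mpowE cm1 muln0.
Qed.

(** Both sides range over the chains [d | e | g], with [e = k * d]. *)
Lemma sum_divisors_swap (V : nmodType) g (F : nat -> nat -> V) : (0 < g)%N ->
  \sum_(k <- divisors g) \sum_(d <- divisors (g %/ k)) F d (k * d)%N =
  \sum_(e <- divisors g) \sum_(d <- divisors e) F d e.
Proof.
move=> g0.
transitivity (\sum_(p <- [seq (d, k * d)%N | k <- divisors g, d <- divisors (g %/ k)])
  F p.1 p.2); first by rewrite big_allpairs_dep.
transitivity (\sum_(p <- [seq (d, e) | e <- divisors g, d <- divisors e])
  F p.1 p.2); last by rewrite big_allpairs_dep.
apply/perm_big/uniq_perm.
- apply: allpairs_uniq_dep => [|k _|]; rewrite ?divisors_uniq//.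
  move=> /= _ _ /allpairsPdep[k1 [d1 [k1g d1g ->]]] /allpairsPdep[k2 [d2 [k2g d2g ->]]].
  case=> <- /= /eqP; rewrite eqn_pmul2r => [/eqP ->//|].
  move: k1g d1g; rewrite -dvdn_divisors// => k1g.
  have g1 : (0 < g %/ k1)%N by rewrite divn_gt0 ?(dvdn_gt0 g0 k1g)// dvdn_leq.
  by rewrite -dvdn_divisors// => /(dvdn_gt0 g1).
- apply: allpairs_uniq_dep => [|k _|]; rewrite ?divisors_uniq//.
  by move=> /= [e1 d1] [e2 d2] _ _ [-> ->].
move=> [d e]; apply/allpairsPdep/allpairsPdep.
  move=> [k [d' [kg d'g [-> ->]]]]; exists (k * d')%N, d'.
  rewrite -dvdn_divisors// in kg; have k0 := dvdn_gt0 g0 kg.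
  have g1 : (0 < g %/ k)%N by rewrite divn_gt0// dvdn_leq.
  rewrite -dvdn_divisors// in d'g; have d0 := dvdn_gt0 g1 d'g.
  split=> //; rewrite -dvdn_divisors// ?muln_gt0 ?k0 ?dvdn_mull//.
  by rewrite mulnC -dvdn_divRL.
move=> [e' [d' [eg de [-> ->]]]]; exists (e' %/ d')%N, d'.
rewrite -dvdn_divisors// in eg; have e0 := dvdn_gt0 g0 eg.
rewrite -dvdn_divisors// in de; have d0 := dvdn_gt0 e0 de.
have ed0 : (0 < e' %/ d')%N by rewrite divn_gt0// dvdn_leq.
have edg : (e' %/ d' %| g)%N by apply: dvdn_trans eg; rewrite -{2}(divnK de) dvdn_mulr.
split; rewrite ?divnK// -dvdn_divisors//; last by rewrite divn_gt0// dvdn_leq.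
by rewrite dvdn_divRL// mulnC divnK.
Qed.

(** Moebius inversion: after collecting the terms in [m / e], their factor is
    the sum of the Moebius function over the divisors of [e]. *)
Lemma sum_coef (m : cmonom nat) : m != mone ->
  \sum_(k <- divisors (mgcd m)) coef (mquo m k) / k%:R =
  multinomial m / (mdeg m)%:R.
Proof.
move=> m1; have g0 := mgcd_gt0 m1.
transitivity ((mdeg m)%:R^-1 * \sum_(k <- divisors (mgcd m))
   \sum_(d <- divisors (mgcd m %/ k)) (mobius d)%:~R * multinomial (mquo m (k * d))).
  rewrite mulr_sumr !big_seq; apply: eq_bigr => k; rewrite -dvdn_divisors// => kg.
  rewrite /coef mgcd_mquo// mulrAC -(mdeg_mquo kg) natrM invfM [in RHS]mulrC.
  rewrite [in LHS]mulrC [_^-1 / _]mulrC; congr (_ * _); apply: eq_bigr => d _.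
  by rewrite mquo_mquo.
rewrite (@sum_divisors_swap _ _ (fun d e => (mobius d)%:~R * multinomial (mquo m e)))//.
rewrite mulrC; congr (_ / _).
rewrite (eq_big_seq (fun e => if e == 1%N then multinomial m else 0)).
  rewrite -big_mkcond/= -big_filter (perm_big [:: 1%N]) ?big_seq1//.
  apply: uniq_perm; rewrite ?filter_uniq ?divisors_uniq// => d.
  by rewrite mem_filter inE; case: eqP => // ->; rewrite -dvdn_divisors ?dvd1n.
move=> e; rewrite -dvdn_divisors// => eg.
rewrite -mulr_suml -rmorph_sum /= sum_mobius ?(dvdn_gt0 g0)//.
case: eqP => [->|_]; last by rewrite mul0r.
by rewrite mul1r; congr multinomial; apply: cmonomP => i; rewrite mquoE divn1.
Qed.

(** * The identity of formal power series *)

(** Sums over a set are finitely supported sums; this evaluates one from a list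
    that carries the support. *)
Lemma fsum_seq (V : nmodType) (I : choiceType) (D : set I) (s : seq I)
    (F : I -> V) : uniq s -> (forall i, i \in s -> D i) ->
  (forall i, D i -> i \notin s -> F i = 0) ->
  \sum_(i \in D) F i = \sum_(i <- s) F i.
Proof.
move=> us sD F0; rewrite [RHS]fsbig_seq//; apply/esym.
apply: fsbig_widen => [i|i [Di /= /negP]].
  exact: sD.
exact: F0.
Qed.

Lemma ratr_div_nat (K : numFieldType) (q : rat) n :
  ratr (q / n%:R) = ratr q / n%:R :> K.
Proof. by rewrite -(ratr_nat K) -fmorph_div. Qed.

Section FormalLogarithm.
Context (K : numFieldType).

Lemma fps_mul_mono (n q : cmonom nat) :
  fps_mul (fps_mono K n) (fps_mono K q) = fps_mono K (mmul n q).
Proof.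
apply/funext => m; rewrite /fps_mul /fps_mono.
have [->|mnq] := eqVneq m (mmul n q).
  rewrite (@fsum_seq _ _ _ [:: (n, q)]) ?big_seq1 ?eqxx ?mulr1//.
    by move=> p; rewrite inE => /eqP ->.
  move=> [p1 p2] _; rewrite inE xpair_eqE negb_and.
  by case/orP => /negPf /= ->; rewrite ?mulr0 ?mul0r.
rewrite (@fsum_seq _ _ _ [::]) ?big_nil// => -[p1 p2] /= pm _.
case: (eqVneq p1 n) => [pn|]; last by rewrite mul0r.
case: (eqVneq p2 q) => [pq|]; last by rewrite mulr0.
by move: mnq; rewrite -pm pn pq eqxx.
Qed.

Lemma fps_pow_mono (n : cmonom nat) k :
  fps_pow (fps_mono K n) k = fps_mono K (mpow n k).
Proof.
by elim: k => // k IH; rewrite /fps_pow iterS -/(fps_pow _ _) IH fps_mul_mono.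
Qed.

Lemma fps_var_sumE (m : cmonom nat) :
  fps_var_sum K m = (mdeg m == 1%N)%:R.
Proof.
rewrite /fps_var_sum /fps_sum /fps_mono; case: eqP => [d1|md].
  have [i mE] := mdeg1_ucm d1.
  rewrite (@fsum_seq _ _ _ [:: i]) ?big_seq1 ?mE ?eqxx// => j _.
  rewrite inE => ji; case: eqP => // /(congr1 (fun m : cmonom nat => m j)).
  by rewrite !cmU eqxx eq_sym (negPf ji).
rewrite (@fsum_seq _ _ _ [::]) ?big_nil// => j _ _; case: eqP => // mj.
by case: md; rewrite mj mdegU.
Qed.

(** By induction on [k]: the first factor contributes one variable [i], and what
    is left of [m] is [divcm m (ucm i)], so the recursion is [multinomial_rec]. *)
Lemma fps_pow_var_sum k (m : cmonom nat) : fps_pow (fps_var_sum K) k m =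
  if mdeg m == k then ratr (multinomial m) else 0.
Proof.
elim: k m => [|k IH] m.
  rewrite /fps_pow /= /fps_mono mdeg_eq0; case: eqP => // ->.
  by rewrite multinomial1 (ratr_nat K 1).
rewrite /fps_pow iterS -/(fps_pow _ _) /fps_mul.
rewrite (@fsum_seq _ _ _ [seq (ucm i, divcm m (ucm i)) | i <- finsupp m]).
- rewrite big_map; case: eqP => [mk|mk].
    have m1 : m != mone by rewrite -mdeg_eq0 mk.
    rewrite (multinomial_rec m1) rmorph_sum /= !big_seq; apply: eq_bigr => i im.
    rewrite fps_var_sumE mdegU mul1r IH.
    by move: mk; rewrite (mdeg_div_ucm im) => -[->]; rewrite eqxx.
  rewrite big_seq big1// => i im; rewrite IH; case: eqP; rewrite ?mulr0// => E.
  by case: mk; rewrite (mdeg_div_ucm im) E.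
- rewrite map_inj_uniq ?fset_uniq// => i j /(congr1 (fun p : cmonom nat * cmonom nat => p.1 i)).
  by rewrite /= !cmU eqxx; case: (eqVneq j i).
- by move=> _ /mapP[i im ->] /=; rewrite cmonom_mulK.
move=> [p q] /= pqm pq; rewrite fps_var_sumE; case: eqP => [p1|]; last by rewrite mul0r.
have [i pE] := mdeg1_ucm p1.
case/negP: pq; apply/mapP; exists i.
  by rewrite -pqm -cmE_neq0 cmM pE cmUU.
rewrite -pqm pE; congr (_, _); apply: cmonomP => j.
by rewrite divcmE cmM addKn.
Qed.

Lemma fps_log_var_sum (m : cmonom nat) :
  - fps_log1m (fps_var_sum K) m =
  if m == mone then 0 else ratr (multinomial m / (mdeg m)%:R).
Proof.
rewrite /fps_log1m opprK /fps_sum; case: eqP => [->|/eqP m1].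
  rewrite (@fsum_seq _ _ _ [::]) ?big_nil// => k /= k0 _.
  by rewrite fps_pow_var_sum mdeg1 ltn_eqF// mul0r.
rewrite (@fsum_seq _ _ _ [:: mdeg m]) ?big_seq1.
- by rewrite fps_pow_var_sum eqxx [RHS]ratr_div_nat.
- by [].
- by move=> i; rewrite inE => /eqP ->; move: m1; rewrite -mdeg_eq0 -lt0n.
move=> k _; rewrite inE => km.
by rewrite fps_pow_var_sum eq_sym (negPf km) mul0r.
Qed.

Lemma fps_log_mono (n m : cmonom nat) k : n != mone -> (0 < k)%N ->
  m = mpow n k -> fps_log1m (fps_mono K n) m = - k%:R^-1.
Proof.
move=> n1 k0 mE; rewrite /fps_log1m /fps_sum (@fsum_seq _ _ _ [:: k]) ?big_seq1//.
- by rewrite fps_pow_mono /fps_mono mE eqxx mul1r.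
- by move=> i; rewrite inE => /eqP ->.
move=> l _; rewrite inE => lk; rewrite fps_pow_mono /fps_mono mE.
case: eqP; rewrite ?mul0r// => /(mpow_inj n1) E.
by rewrite E eqxx in lk.
Qed.

Lemma fps_log_mono0 (n m : cmonom nat) :
  (forall k, (0 < k)%N -> m <> mpow n k) -> fps_log1m (fps_mono K n) m = 0.
Proof.
move=> H; rewrite /fps_log1m /fps_sum (@fsum_seq _ _ _ [::]) ?big_nil ?oppr0//.
move=> k /= k0 _; rewrite fps_pow_mono /fps_mono.
by case: eqP => [/H|]; rewrite ?mul0r//; move/(_ k0).
Qed.
End FormalLogarithm.

(** The indices [n] such that [x^m] occurs in [log (1 - x^n)]. *)
Definition roots_of (m : cmonom nat) :=
  if m == mone then [::] else [seq mquo m k | k <- divisors (mgcd m)].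

Lemma fps_term_roots (R : realType) (n m : cmonom nat) :
  n != mone -> n \notin roots_of m -> fps_term R n m = 0.
Proof.
move=> n1 nm; rewrite /fps_term fps_log_mono0 ?mulr0// => k k0 mE.
have m1 : m != mone by rewrite mE mpow_eq1.
case/negP: nm; rewrite /roots_of (negPf m1); apply/mapP; exists k.
  by rewrite -dvdn_divisors ?mgcd_gt0// mE dvd_mgcd_mpow.
by rewrite mE mquo_mpow.
Qed.

Lemma roots_of_uniq m : uniq (roots_of m).
Proof.
rewrite /roots_of; case: eqP => // /eqP m1.
rewrite map_inj_in_uniq ?divisors_uniq// => k l.
rewrite -!dvdn_divisors ?mgcd_gt0// => km lm E.
have := mdeg_mquo km; rewrite -(mdeg_mquo lm) E => /eqP.
by rewrite eqn_pmul2r ?lt0n ?mdeg_eq0 ?mquo_neq1// => /eqP.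
Qed.

(** Only the finitely many roots of [m] contribute to the coefficient of [x^m],
    and their contributions are added up by [sum_coef]. *)
Lemma formal_identity (R : realType) :
  fps_summable nonzero_exponents (@fps_term R) /\
  (forall m : cmonom nat,
    - fps_log1m (fps_var_sum R[i]) m =
    - fps_sum nonzero_exponents (@fps_term R) m).
Proof.
split=> m.
  apply: (@sub_finite_set _ _ [set` roots_of m]) (finite_seq _) => n [n1 nm] /=.
  by apply: contraNT nm => nm; rewrite fps_term_roots.
rewrite fps_log_var_sum /fps_sum (@fsum_seq _ _ _ (roots_of m)) ?roots_of_uniq//.
- rewrite /roots_of; case: eqP => [|/eqP m1]; first by rewrite big_nil oppr0.
  rewrite big_map -sum_coef// rmorph_sum -sumrN !big_seq; apply: eq_bigr => k.
  rewrite -dvdn_divisors ?mgcd_gt0// => km.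
  rewrite /fps_term (@fps_log_mono _ _ _ k) ?mquo_neq1 ?mpow_mquo//.
    by rewrite mulrN opprK [LHS]ratr_div_nat.
  exact: dvdn_gt0 (mgcd_gt0 m1) km.
- move=> n; rewrite /roots_of; case: eqP => // /eqP m1 /mapP[k].
  by rewrite -dvdn_divisors ?mgcd_gt0// => km ->; exact: mquo_neq1.
by move=> n n1 nm; exact: fps_term_roots.
Qed.

(** * Primitive words *)

Lemma flatten_nseq_comm (T : Type) (u : seq T) d :
  u ++ flatten (nseq d u) = flatten (nseq d u) ++ u.
Proof. by elim: d => [|d IH] /=; rewrite ?cats0// -catA -IH. Qed.

Lemma rot_flatten_nseq (T : Type) (u : seq T) d :
  rot (size u) (flatten (nseq d u)) = flatten (nseq d u).
Proof. by case: d => [|d] //=; rewrite rot_size_cat flatten_nseq_comm. Qed.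

(** The first block of length [p] is followed by itself, and dropping it leaves
    a word that is again invariant, so induction on [d] applies. *)
Lemma rot_fixed_power (T : Type) d p (w : seq T) : size w = (d * p)%N ->
  rot p w = w -> w = flatten (nseq d (take p w)).
Proof.
elim: d w => [|d IH] w; first by rewrite mul0n => /size0nil ->.
rewrite mulSn => sw; rewrite /rot.
set u := take p w; set v := drop p w => rw.
have su : size u = p by rewrite size_takel// sw leq_addr.
have sv : size v = (d * p)%N by rewrite size_drop sw addKn.
have wE : w = u ++ v by rewrite cat_take_drop.
rewrite /= {1}wE; congr (_ ++ _); case: d => [|d] in sw sv IH *.
  exact/size0nil.
have uE : u = take p v.
  by rewrite /u -[in LHS]rw takel_cat// sv mulSn leq_addr.
have vE : v = drop p v ++ u.
  have := congr1 (drop p) rw; rewrite -{1}(cat_take_drop p v) -uE -catA.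
  by rewrite drop_size_cat// => ->.
by rewrite uE; apply: IH => //; rewrite /rot -uE.
Qed.

Lemma count_flatten_nseq (T : Type) (a : pred T) (u : seq T) d :
  count a (flatten (nseq d u)) = (d * count a u)%N.
Proof. by elim: d => //= d IH; rewrite count_cat IH mulSn. Qed.

(** Taking [d]-th powers is a bijection from the words with content [m / d] to
    the invariant words with content [m]; the counts of letters in a [d]-th
    power are multiples of [d], so there are none unless [d] divides [mgcd m]. *)
Lemma count_fixed_words (m : cmonom nat) d p : (0 < d)%N ->
  mdeg m = (d * p)%N ->
  count (fun w => rot p w == w) (words m) =
  if (d %| mgcd m)%N then size (words (mquo m d)) else 0%N.
Proof.
move=> d0 mE; case: ifPn => dm; last first.
  apply/eqP; rewrite -leqn0 leqNgt -has_count; apply: contra dm => /hasP[w wm /eqP rw].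
  have wE := rot_fixed_power (etrans (size_word wm) mE) rw.
  apply/dvd_mgcdP => i; rewrite -(mem_words m w wm i) wE count_flatten_nseq.
  exact: dvdn_mulr.
have mq : mdeg (mquo m d) = p.
  by apply/eqP; rewrite -(eqn_pmul2l d0) mdeg_mquo// mE.
rewrite -size_filter -(size_map (fun u => flatten (nseq d u)) (words _)).
apply/perm_size/uniq_perm.
- by rewrite filter_uniq ?permutations_uniq.
- rewrite map_inj_in_uniq ?permutations_uniq// => u v um vm.
  case: d d0 {mE dm} mq um vm => // d _ mq um vm /= E.
  have := congr1 (take p) E.
  by rewrite !take_size_cat ?(size_word um) ?(size_word vm).
move=> w; rewrite mem_filter; apply/andP/mapP => [[/eqP rw wm]|[u um ->]].
  have wE := rot_fixed_power (etrans (size_word wm) mE) rw.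
  exists (take p w) => //; apply/mem_words => i; apply/eqP.
  rewrite -(eqn_pmul2l d0) -count_flatten_nseq -wE mquoE (mem_words m w wm).
  by rewrite mulnC divnK//; move/dvd_mgcdP: dm.
split; first by rewrite -{1}mq -(size_word um) rot_flatten_nseq.
apply/mem_words => i; rewrite count_flatten_nseq (mem_words _ _ um) mquoE.
by rewrite mulnC divnK//; move/dvd_mgcdP: dm.
Qed.

Lemma iter_eq_order (T : finType) (f : T -> T) (x : T) k : injective f ->
  (iter k f x == x) = (order f x %| k)%N.
Proof.
move=> fI; have fo : iter (order f x) f x = x := iter_order fI x.
have iterM q : iter (q * order f x) f x = x.
  by elim: q => //= q IH; rewrite mulSn iterD IH.
rewrite {1}(divn_eq k (order f x)) addnC iterD iterM /dvdn.
apply/eqP/eqP => [E|->//].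
have := findex_iter (ltn_pmod k (order_gt0 f x)); rewrite E => <-.
by apply/eqP; rewrite findex_eq0.
Qed.

(** For divisors [d] and [o] of [N], [o] divides [N / d] if and only if [d]
    divides [N / o]. *)
Lemma sum_mobius_dvd N o : (0 < N)%N -> (o %| N)%N ->
  \sum_(d <- divisors N | (o %| N %/ d)%N) mobius d = (o == N)%:R :> int.
Proof.
move=> N0 oN; have o0 := dvdn_gt0 N0 oN.
have No0 : (0 < N %/ o)%N by rewrite divn_gt0// dvdn_leq.
transitivity (\sum_(d <- divisors (N %/ o)) mobius d).
  rewrite -big_filter; apply/perm_big/uniq_perm; rewrite ?filter_uniq ?divisors_uniq// => d.
  rewrite mem_filter -!dvdn_divisors//; apply/andP/idP => [[od dN]|dNo].
    by rewrite dvdn_divRL// mulnC -dvdn_divRL.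
  have dN : (d %| N)%N by apply: dvdn_trans dNo _; rewrite -{2}(divnK oN) dvdn_mulr.
  by rewrite dvdn_divRL// mulnC -dvdn_divRL.
rewrite sum_mobius//; congr ((_ : bool)%:R).
apply/eqP/eqP => [E|->]; last by rewrite divnn N0.
by rewrite -(divnK oN) E mul1n.
Qed.

Section Rotation.
Context (m : cmonom nat).
Local Notation T := (seq_sub (words m)).

Lemma perm_enum_word : perm_eq [seq ssval w | w <- enum {: T}] (words m).
Proof.
apply: uniq_perm; rewrite ?permutations_uniq//.
  by rewrite map_inj_uniq ?enum_uniq//; exact: val_inj.
move=> w; apply/mapP/idP => [[u _ ->]|wm]; first exact: ssvalP.
by exists (SeqSub wm); rewrite ?mem_enum.
Qed.

Lemma rotr_word (w : T) : rotr 1 (ssval w) \in words m.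
Proof.
apply/mem_words => i; rewrite -(mem_words _ _ (ssvalP w) i).
by apply/permP; rewrite perm_rotr.
Qed.

Definition rotate (w : T) : T := SeqSub (rotr_word w).

Lemma rotate_inj : injective rotate.
Proof. by move=> u v [] /rotr_inj uv; apply: val_inj. Qed.

Lemma iter_rotate k (w : T) :
  ssval (iter k rotate w) = iter k (rotr 1) (ssval w).
Proof. by elim: k => //= k ->. Qed.

Lemma iter_rot1 (w : seq nat) k : (k <= size w)%N -> iter k (rot 1) w = rot k w.
Proof.
elim: k => [|k IH] kw; first by rewrite rot0.
by rewrite iterS IH 1?ltnW// -rotS.
Qed.

(** Rotations to the left and to the right have the same fixed words. *)
Lemma iter_rotate_fixed k (w : T) : (k <= mdeg m)%N ->
  (iter k rotate w == w) = (rot k (ssval w) == ssval w).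
Proof.
move=> km; have sw : (k <= size (ssval w))%N by rewrite (size_word (ssvalP w)).
rewrite -iter_rot1// -val_eqE /= iter_rotate.
have K : cancel (iter k (rotr 1)) (iter k (@rot nat 1)).
  by elim: {km sw} k => // k IH v; rewrite iterSr iterS rotrK IH.
apply/eqP/eqP => [E|E]; first by rewrite -[in LHS]E K.
have L : cancel (iter k (@rot nat 1)) (iter k (rotr 1)).
  by elim: {km sw K E} k => // k IH v; rewrite iterSr iterS rotK IH.
by rewrite -[in LHS]E L.
Qed.

Lemma order_rotate_dvd (w : T) : (order rotate w %| mdeg m)%N.
Proof.
rewrite -iter_eq_order; last exact: rotate_inj.
by rewrite iter_rotate_fixed// -(size_word (ssvalP w)) rot_size.
Qed.

(** For a word with stabilizer of order [s], the divisors [d] of [mdeg m] such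
    that the rotation by [mdeg m / d] fixes the word are the divisors of [s], and
    the Moebius function sums to 0 over them unless [s = 1].  Exchanging the sums
    over words and over [d] leaves the counts of fixed words. *)
Lemma card_primitive : m != mone ->
  #|[pred w : T | order rotate w == mdeg m]|%:R = (mdeg m)%:R * coef m.
Proof.
move=> m1; have N0 : (0 < mdeg m)%N by rewrite lt0n mdeg_eq0.
have g0 := mgcd_gt0 m1.
have gN : (mgcd m %| mdeg m)%N by rewrite -(mdeg_mquo (dvdnn _)) dvdn_mulr.
rewrite /coef mulVKf ?pnatr_eq0 -?lt0n//.
transitivity (\sum_(d <- divisors (mdeg m)) (mobius d)%:~R *
   (count (fun w => rot (mdeg m %/ d) w == w) (words m))%:R : rat).
  transitivity (\sum_(w : T) \sum_(d <- divisors (mdeg m))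
     (mobius d)%:~R * (rot (mdeg m %/ d) (ssval w) == ssval w)%:R : rat).
    rewrite -sum1_card big_mkcond natr_sum; apply: eq_bigr => w _.
    rewrite inE -mulrb [RHS](_ : _ = (order rotate w == mdeg m)%:R); last first.
      rewrite -[RHS](rmorph_nat intr) -sum_mobius_dvd ?order_rotate_dvd// rmorph_sum.
      rewrite [RHS]big_mkcond big_seq [RHS]big_seq; apply: eq_bigr => d /=.
      rewrite -dvdn_divisors// => dN.
      rewrite -iter_rotate_fixed ?leq_div// iter_eq_order; last exact: rotate_inj.
      by case: ifP; rewrite ?mulr1 ?mulr0.
    by case: (_ == _).
  rewrite exchange_big; apply: eq_bigr => d _; rewrite -mulr_sumr -natr_sum.
  congr (_ * _%:R).
  rewrite -sum1_count [RHS]big_mkcond /=.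
  rewrite -(perm_big _ perm_enum_word) big_map big_enum; apply: eq_bigr => w _.
  by case: (_ == _).
rewrite (bigID (fun d => d %| mgcd m)%N) /= [X in _ + X]big1_seq ?addr0; last first.
  move=> d /andP[dg]; rewrite -dvdn_divisors// => dN.
  rewrite (count_fixed_words (dvdn_gt0 N0 dN)) ?(negPf dg) ?mulr0//.
  by rewrite mulnC divnK.
rewrite -big_filter (perm_big (divisors (mgcd m))); last first.
  apply: uniq_perm; rewrite ?filter_uniq ?divisors_uniq// => d.
  rewrite mem_filter -!dvdn_divisors// andb_idr// => dg; exact: dvdn_trans gN.
rewrite !big_seq; apply: eq_bigr => d; rewrite -dvdn_divisors// => dg.
have dN := dvdn_trans dg gN.
rewrite (@count_fixed_words _ d) ?(dvdn_gt0 g0 dg)//; last by rewrite mulnC divnK.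
by rewrite dg size_words.
Qed.

(** One representative in each orbit of length [mdeg m]. *)
Definition primitive_roots : {pred T} :=
  [predI froots rotate & [pred w | order rotate w == mdeg m]].

Lemma card_primitive_roots : m != mone -> #|primitive_roots|%:R = coef m.
Proof.
move=> m1.
have := @fcard_order_set _ _ rotate_inj (mdeg m) [pred w | order rotate w == mdeg m].
have sub : [pred w | order rotate w == mdeg m] \subset order_set rotate (mdeg m).
  by apply/fintype.subsetP => w; rewrite !inE.
have cl : fclosed rotate [pred w | order rotate w == mdeg m].
  move=> u v /eqP <-; rewrite !inE; congr (_ == _).
  apply: (@eq_order_cycle _ rotate (orbit rotate u)); rewrite ?in_orbit//.
    exact: cycle_orbit rotate_inj u.
  by apply: mem_orbit; rewrite in_orbit.
move=> /(_ sub cl) /(congr1 (fun k => k%:R : rat)); rewrite card_primitive// natrM mulrC.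
by move/mulfI; apply; rewrite pnatr_eq0 mdeg_eq0.
Qed.
End Rotation.

(** * Configurations and their orbits *)

Lemma card_set_seq (T : choiceType) (s : seq T) :
  uniq s -> ([set` s] #= `I_(size s))%card.
Proof.
move=> us; have -> : [set` s] = [set` [fset x in s]%fset].
  by apply/seteqP; split => x /=; rewrite inE.
by apply/card_eq_fsetP; rewrite card_fseq undup_id.
Qed.

Section Configurations.
Context (m : cmonom nat).
Local Notation N := (mdeg m).
Local Notation T := (seq_sub (words m)).

(** Words are plain lists, for which counting is convenient; this map carries
    the results over to families of sets. *)
Definition config (w : seq nat) : nat -> {set 'I_N} :=
  fun i => [set j : 'I_N | nth 0%N w j == i]%SET.

Lemma config_inj (v w : seq nat) : size v = N -> size w = N ->
  config v = config w -> v = w.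
Proof.
move=> sv sw E; apply: (@eq_from_nth _ 0%N); first by rewrite sv.
move=> j; rewrite sv => jN; apply/eqP; rewrite eq_sym.
have := congr1 (fun A : nat -> {set 'I_N} => Ordinal jN \in A (nth 0%N v j)) E.
by rewrite !inE /= eqxx => <-.
Qed.

Lemma card_config (w : seq nat) i : size w = N -> #|config w i| = count_mem i w.
Proof.
move=> sw; rewrite -[in RHS](mkseq_nth 0%N w) sw /mkseq.
rewrite count_map -val_enum_ord count_map cardE size_filter enumT.
by apply: eq_count => j; rewrite !inE.
Qed.

Lemma config_words (w : seq nat) : w \in words m -> configurations m (config w).
Proof.
move=> wm; split => [i|i j ij]; last first.
  by apply/setP => k; rewrite !inE; apply/andP => -[/eqP ki /eqP kj]; apply: ij; rewrite -ki.
by rewrite -(mem_words _ _ wm) card_config ?(size_word wm).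
Qed.

(** Disjoint sets whose sizes add up to [N] cover ['I_N], so every position has
    exactly one letter. *)
Lemma config_surj (A : nat -> {set 'I_N}) : configurations m A ->
  exists2 w, w \in words m & config w = A.
Proof.
move=> [cA dA].
pose c j := [seq i <- finsupp m | j \in A i].
have c1 j : (size (c j) <= 1)%N.
  rewrite leqNgt; apply/negP; case E : (c j) => [|a [|b s]] // _.
  have : a \in c j by rewrite E !inE eqxx.
  have : b \in c j by rewrite E !inE eqxx orbT.
  rewrite !mem_filter => /andP[jb _] /andP[ja _].
  have : uniq (c j) by rewrite filter_uniq ?fset_uniq.
  rewrite E /= inE negb_or => /andP[/andP[/eqP ab _] _].
  by have /setP/(_ j) := dA _ _ ab; rewrite !inE ja jb.
have sumc : (\sum_(j : 'I_N) size (c j) = N)%N.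
  under eq_bigr do rewrite size_filter -sum1_count big_mkcond.
  rewrite exchange_big /= [RHS]mdegE; apply: eq_bigr => i _.
  by rewrite -big_mkcond /= sum1_card cA.
have cE j : size (c j) = 1%N.
  apply/eqP; rewrite eqn_leq c1 /= lt0n; apply: contraPN sumc => /eqP c0.
  (* An uncovered position j would leave a total of at most N - 1. *)
  rewrite (bigD1 j) //= c0 add0n; apply/eqP; rewrite ltn_eqF//.
  apply: (@leq_ltn_trans (\sum_(i < N | i != j) 1)%N); first exact: leq_sum.
  rewrite sum1_card -[X in (_ < X)%N]card_ord -(cardC (pred1 j)) card1 ltnS.
  by apply: subset_leq_card; apply/fintype.subsetP => i.
pose w := [seq head 0%N (c j) | j <- enum 'I_N].
have sw : size w = N by rewrite size_map size_enum_ord.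
have AE : config w = A.
  apply/funext => i; apply/setP => j; rewrite inE (nth_map j) ?size_enum_ord//.
  rewrite nth_ord_enum; have := cE j; case E : (c j) => [|a [|]]//= _.
  have := mem_head a [::]; rewrite -E mem_filter => /andP[ja _].
  apply/eqP/idP => [<-//|ji]; apply: contrapT => ai.
  by have /setP/(_ j) := dA _ _ ai; rewrite !inE ja ji.
by exists w => //; apply/mem_words => i; rewrite -cA -AE card_config.
Qed.

Lemma translate_config (w : seq nat) : size w = N ->
  translate (config (rot 1 w)) = config w.
Proof.
move=> sw; apply/funext => i; apply/setP => j.
have N0 : (0 < N)%N := leq_ltn_trans (leq0n _) (ltn_ord j).
rewrite -(ord_predK j) /translate mem_imset; last exact: ordS_inj.
rewrite !inE /=; congr (_ == _).
have : ((j + N).-1 %% N < N)%N by rewrite ltn_mod.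
move: ((j + N).-1 %% N)%N => k.
case: w sw => [|a s] sw; first by rewrite -sw in N0.
rewrite rot1_cons nth_rcons -sw /= ltnS leq_eqVlt.
case/orP => [/eqP ->|ks]; first by rewrite ltnn eqxx modnn.
by rewrite ks modn_small.
Qed.

Lemma iter_translate_config k (w : T) :
  iter k (@translate N) (config (ssval w)) = config (ssval (iter k (@rotate m) w)).
Proof.
elim: k => //= k ->; rewrite -[in LHS](rotrK 1 (ssval _)) translate_config//.
by rewrite size_rotr (size_word (ssvalP _)).
Qed.

(** The first [N] iterates exhaust the orbit because its length divides [N]. *)
Lemma zmod_orbit_config (w : T) : m != mone ->
  zmod_orbit (config (ssval w)) =
  (config \o @ssval _ _) @` [set` orbit (@rotate m) w].
Proof.
move=> m1; have N0 : (0 < N)%N by rewrite lt0n mdeg_eq0.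
apply/seteqP; split => [_ [k _ <-]|_ [v /= /trajectP[k ko ->] <-]].
  exists (iter k (@rotate m) w); last by rewrite /= iter_translate_config.
  by rewrite /= -fconnect_orbit fconnect_iter.
have kN : (k < N)%N := leq_trans ko (dvdn_leq N0 (order_rotate_dvd w)).
by exists (Ordinal kN) => //=; rewrite iter_translate_config.
Qed.

Lemma config_val_inj : injective (config \o @ssval _ (words m)).
Proof.
move=> u v /config_inj uv; apply: val_inj; apply: uv;
  by rewrite (size_word (ssvalP _)).
Qed.

Lemma card_zmod_orbit (w : T) : m != mone ->
  (zmod_orbit (config (ssval w)) #= `I_(order (@rotate m) w))%card.
Proof.
move=> m1; rewrite zmod_orbit_config// -size_orbit.
apply: card_eq_trans (card_set_seq (orbit_uniq _ _)).
by apply: inj_card_eq => u v _ _; exact: config_val_inj.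
Qed.

(** Each full orbit is the orbit of the representative of any of its words, and
    an orbit of configurations has as many elements as the orbit of words. *)
Lemma full_orbitsE : m != mone -> full_orbits m =
  (fun w : T => zmod_orbit (config (ssval w))) @` [set` @primitive_roots m].
Proof.
move=> m1; have rsym : connect_sym (frel (@rotate m)) := fconnect_sym (@rotate_inj m).
apply/seteqP; split => [Z [[A Am <-] ON]|_ [w /= /andP[_ /eqP wN] <-]]; last first.
  split; last by have := card_zmod_orbit w m1; rewrite wN.
  by exists (config (ssval w)) => //; exact/config_words/ssvalP.
have [w wm AE] := config_surj Am; pose u : T := SeqSub wm.
rewrite -AE -[w]/(ssval u) in ON *.
pose v := froot (@rotate m) u.
have uv : fconnect (@rotate m) u v := connect_root _ u.
have Ouv : orbit (@rotate m) v =i orbit (@rotate m) u.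
  by move=> x; rewrite -!fconnect_orbit (same_connect rsym uv).
have Euv : zmod_orbit (config (ssval v)) = zmod_orbit (config (ssval u)).
  rewrite !zmod_orbit_config//; congr (_ @` _).
  by apply/seteqP; split => x /=; rewrite Ouv.
exists v => //; rewrite /= !inE (roots_root rsym) /=.
have := card_zmod_orbit v m1; rewrite Euv => /card_esym.
by move=> /card_eq_trans/(_ ON)/card_eq_II ->.
Qed.

Lemma full_orbits_inj : m != mone ->
  {in [set` @primitive_roots m] &,
   injective (fun w : T => zmod_orbit (config (ssval w)))}.
Proof.
move=> m1 u v; rewrite !inE => /andP[/eqP ru _] /andP[/eqP rv _] E.
have : zmod_orbit (config (ssval v)) (config (ssval u)).
  by rewrite -E zmod_orbit_config//; exists u => //=; exact: in_orbit.
rewrite zmod_orbit_config// => -[x /= xv /config_val_inj xu].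
have rsym : connect_sym (frel (@rotate m)) := fconnect_sym (@rotate_inj m).
move: xv; rewrite xu -fconnect_orbit => /(fingraph.rootP rsym) vu.
by rewrite -[LHS]ru -[RHS]rv; exact/esym.
Qed.
End Configurations.

Lemma coef_full_orbits (n : cmonom nat) : nonzero_exponents n ->
  exists2 k : nat, coef n = k%:R & (full_orbits n #= `I_k)%card.
Proof.
move=> n1; exists #|@primitive_roots n|; first by rewrite card_primitive_roots.
rewrite full_orbitsE//; apply: card_eq_trans.
  by apply: inj_card_eq; exact: full_orbits_inj.
rewrite cardE; have := card_set_seq (enum_uniq (@primitive_roots n)).
by congr card_eq; apply/seteqP; split => w /=; rewrite mem_enum.
Qed.

(** * Unconditional sums *)

#[local] Existing Instance totally_filter.

Section HasSum.
Context (K : numFieldType).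

Lemma has_sumP (I : choiceType) (D : set I) (f : I -> K) (s : K) :
  has_sum D f s <->
  (forall e, 0 < e -> exists F0 : {fset I}, forall F : {fset I},
     (F0 `<=` F)%fset -> `|s - \sum_(i <- F | i \in D) f i| < e).
Proof.
split => [/cvgrPdist_lt fs e e0|H].
  have [F0 _ F0e] := fs e e0.
  by exists F0 => F F0F; exact: F0e.
apply/cvgrPdist_lt => e e0; have [F0 F0e] := H e e0.
by exists F0 => // F; exact: F0e.
Qed.

Lemma has_sum_unique (I : choiceType) (D : set I) (f : I -> K) (s t : K) :
  has_sum D f s -> has_sum D f t -> s = t.
Proof. by apply: cvg_unique; exact: norm_hausdorff. Qed.

Lemma eq_has_sum (I : choiceType) (D : set I) (f g : I -> K) (s : K) :
  (forall i, D i -> f i = g i) -> has_sum D f s -> has_sum D g s.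
Proof.
move=> fg /has_sumP fs; apply/has_sumP => e e0; have [F0 F0e] := fs e e0.
exists F0 => F F0F; rewrite -(eq_bigr _ (fun i iD => fg i (set_mem iD))).
exact: F0e.
Qed.

Lemma has_sumZ (I : choiceType) (D : set I) (f : I -> K) (s c : K) :
  has_sum D f s -> has_sum D (fun i => c * f i) (c * s).
Proof.
rewrite /has_sum => fs; under eq_fun do rewrite -mulr_sumr.
by apply: cvgM => //; exact: cvg_cst.
Qed.

Lemma has_sum_seq (I : choiceType) (D : set I) (s : seq I) (f : I -> K) :
  uniq s -> (forall i, i \in s -> D i) ->
  (forall i, D i -> i \notin s -> f i = 0) ->
  has_sum D f (\sum_(i <- s) f i).
Proof.
move=> us sD f0; apply/has_sumP => e e0; exists [fset i in s]%fset => F sF.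
suff -> : \sum_(i <- F | i \in D) f i = \sum_(i <- s) f i by rewrite subrr normr0.
rewrite (bigID (fun i => i \in s)) /= [X in _ + X]big1 ?addr0; last first.
  by move=> i /andP[/set_mem Di]; exact: f0.
rewrite -big_filter; apply/perm_big/uniq_perm; rewrite ?filter_uniq ?fset_uniq//.
move=> i; rewrite mem_filter; apply/idP/idP => [/andP[/andP[]]//|si].
rewrite si (mem_set (sD _ si)) /=; apply: (fsubsetP sF).
by rewrite inE.
Qed.

(** Let [F0] be a finite set after which the partial sums stay close to [s].  For
    a finite [G] containing the image of [F0], take finite parts of the fibres
    over [G] whose sums are close to the [g i], enlarged by [F0]: their union
    contains [F0], so its partial sum is close both to [s] and to the sum of [g]
    over [G]. *)
Lemma has_sum_fibers (I J : choiceType) (D : set J) (E : set I) (p : J -> I)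
    (f : J -> K) (g : I -> K) (s : K) :
  (forall j, D j -> E (p j)) -> has_sum D f s ->
  (forall i, E i -> has_sum (D `&` [set j | p j = i]) f (g i)) ->
  has_sum E g s.
Proof.
move=> DE /has_sumP fs gs; apply/has_sumP => e e0.
have e20 : 0 < e / 2 by rewrite divr_gt0.
have [F0 F0e] := fs _ e20; exists (p @` F0)%fset => G F0G.
pose eta := e / 2 / (size G).+1%:R.
have eta0 : 0 < eta by rewrite divr_gt0.
have /choice[H HP] : forall i, exists H : {fset J}, E i -> forall F : {fset J},
    (H `<=` F)%fset -> `|g i - \sum_(j <- F | j \in D `&` [set j | p j = i]) f j| < eta.
  move=> i; have [Ei|nEi] := pselect (E i); last by exists fset0.
  by have /has_sumP/(_ _ eta0)[H HP] := gs i Ei; exists H.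
pose F1 := (F0 `|` \bigcup_(i <- G) H i)%fset.
pose F := [fset j in F1 | p j \in G]%fset.
have F0F : (F0 `<=` F)%fset.
  apply/fsubsetP => j jF0; rewrite !inE jF0 /=.
  by apply: (fsubsetP F0G); apply/imfsetP; exists j.
have HF1 i : i \in G -> (H i `<=` F1)%fset.
  by move=> iG; apply: fsubset_trans (fsubsetUr _ _); exact: bigfcup_sup.
have AB : \sum_(i <- G | i \in E) \sum_(j <- F1 | j \in D `&` [set j | p j = i]) f j =
    \sum_(j <- F | j \in D) f j.
  under eq_bigr => i Ei do rewrite big_mkcond.
  rewrite exchange_big /=.
  have -> : \sum_(j <- F | j \in D) f j =
      \sum_(j <- F1) if (j \in D) && (p j \in G) then f j else 0.
    rewrite -big_mkcond -[LHS]big_filter -[RHS]big_filter; apply/perm_big/uniq_perm;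
      rewrite ?filter_uniq ?fset_uniq// => j.
    have FE : (j \in F) = (j \in F1) && (p j \in G) by rewrite /F inE /=.
    by rewrite !mem_filter FE; case: (j \in D); case: (j \in F1); case: (p j \in G).
  (* A point j over G lies over exactly one index of G, namely p j. *)
  apply: eq_bigr => j _; case: ifPn => [/andP[/set_mem Dj jG]|nj].
    rewrite big_mkcond (bigD1_seq (p j)) ?fset_uniq//= ?(mem_set (DE _ Dj)) ?mem_set//.
    rewrite big1 ?addr0// => i ij; case: ifP => // _; rewrite memNset// => -[_ /= pij].
    by rewrite pij eqxx in ij.
  rewrite big1_seq// => i /andP[_ iG]; case: ifPn => // /set_mem [Dj pji].
  by rewrite pji iG andbT mem_set in nj.
have -> : s - \sum_(i <- G | i \in E) g i =
  (s - \sum_(j <- F | j \in D) f j) - \sum_(i <- G | i \in E)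
    (g i - \sum_(j <- F1 | j \in D `&` [set j | p j = i]) f j).
  by rewrite sumrB opprB addrA AB subrK.
rewrite (le_lt_trans (ler_normB _ _))// [ltRHS]splitr ltr_leD ?F0e//.
rewrite (le_trans (ler_norm_sum _ _ _))//.
apply: (@le_trans _ _ (\sum_(i <- G) eta)).
  rewrite big_mkcond !big_seq; apply: ler_sum => i iG; case: ifPn => [/set_mem Ei|_].
    by apply/ltW/HP => //; exact: HF1.
  exact: ltW.
rewrite big_const_seq count_predT iter_addr_0 /eta -[leLHS]mulr_natr.
by rewrite mulrAC ler_pdivrMr// ler_pM2l// ler_nat.
Qed.
End HasSum.

(** The initial segments of the integers are cofinal among their finite subsets. *)
Lemma has_sum_series (K : numFieldType) (u : nat -> K) (s : K) :
  has_sum [set: nat] u s -> limn (series u) = s.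
Proof.
move=> /has_sumP us; apply: cvg_lim; first exact: norm_hausdorff.
apply/cvgrPdist_lt => e e0; have [F0 F0e] := us e e0.
exists (\max_(i <- F0) i).+1 => // n /= n0.
have := F0e [fset i in iota 0 n]%fset; rewrite /series /=.
have -> : \sum_(i <- [fset i in iota 0 n]%fset | i \in [set: nat]) u i =
          \sum_(0 <= k < n) u k.
  rewrite /index_iota subn0 -big_filter; apply/perm_big/uniq_perm.
  - by rewrite filter_uniq ?fset_uniq.
  - exact: iota_uniq.
  by move=> i; rewrite mem_filter in_setT !inE.
apply; apply/fsubsetP => i iF0; rewrite inE mem_iota /= add0n.
apply: leq_ltn_trans n0; exact: leq_bigmax_seq.
Qed.

Section Existence.
Context (R : realType).

Lemma sum_le_esum (I : choiceType) (D : set I) (f : I -> R) (F : {fset I}) :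
  ((\sum_(i <- F | i \in D) f i)%:E <= \esum_(i in D) (f i)%:E)%E.
Proof.
pose G := [fset i in F | i \in D]%fset.
apply: esum_ge; exists [set` G].
  by split; [exact: finite_fset|move=> i /=; rewrite !inE => /andP[_ /set_mem]].
rewrite fsbig_finite//= set_fsetK sumEFin lee_fin le_eqVlt; apply/orP; left.
rewrite -big_filter; apply/eqP/perm_big/uniq_perm; rewrite ?filter_uniq ?fset_uniq//.
by move=> i; rewrite mem_filter /G [in RHS]inE /= andbC.
Qed.

Lemma esum_le (I : choiceType) (D : set I) (f : I -> R) (M : \bar R) :
  (forall F : {fset I}, [set` F] `<=` D -> ((\sum_(i <- F) f i)%:E <= M)%E) ->
  (\esum_(i in D) (f i)%:E <= M)%E.
Proof.
move=> H; apply: ge_ereal_sup => _ [A [fA AD] <-].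
rewrite fsbig_finite//= sumEFin; apply: H => i /=.
by rewrite in_fset_set// => /set_mem /AD.
Qed.

(** A finite set whose sum is within [e] of the supremum leaves less than [e] to
    the finite sets that avoid it. *)
Lemma esum_tail (I : choiceType) (D : set I) (f : I -> R) (e : R) :
  (forall i, 0 <= f i) -> (\esum_(i in D) (f i)%:E < +oo)%E -> 0 < e ->
  exists F0 : {fset I}, forall F : {fset I}, (forall i, i \in F -> i \notin F0) ->
    \sum_(i <- F | i \in D) f i < e.
Proof.
move=> f0 foo e0.
have fE : \esum_(i in D) (f i)%:E \is a fin_num.
  by rewrite ge0_fin_numE// esum_ge0// => i _; rewrite lee_fin.
have := ub_ereal_sup_adherent e0 fE.
move=> [_ [A [fA AD] <-]] lt.
exists (fset_set A) => F FA.
have := sum_le_esum D f (F `|` fset_set A)%fset.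
have -> : \sum_(i <- (F `|` fset_set A)%fset | i \in D) f i =
    \sum_(i <- F | i \in D) f i + \sum_(i <- fset_set A) f i.
  rewrite -[LHS]big_filter -[X in _ = X + _]big_filter -big_cat; apply/perm_big/uniq_perm.
  - by rewrite filter_uniq ?fset_uniq.
  - rewrite cat_uniq filter_uniq ?fset_uniq// andbT; apply/hasPn => i iA.
    by rewrite mem_filter negb_and orbC; apply/orP; left; apply: contraL iA; exact: FA.
  move=> i; rewrite mem_filter inE mem_cat mem_filter andb_orr; congr (_ || _).
  by rewrite in_fset_set// andb_idl// => /set_mem/AD/mem_set.
move: lt fE; rewrite -/(esum D (fun i => (f i)%:E)) fsbig_finite//= sumEFin.
case: (esum _ _) => [r||]//; rewrite -EFinB lte_fin lee_fin; lra.
Qed.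

(** The net of finite partial sums is Cauchy by [esum_tail]. *)
Lemma has_sum_real (I : choiceType) (D : set I) (f : I -> R) :
  (\esum_(i in D) `|f i|%:E < +oo)%E -> exists s, has_sum D f s.
Proof.
move=> foo.
suff : cvg ((fun F : {fset I} => \sum_(i <- F | i \in D) f i) @ totally).
  by move=> fc; exists (lim ((fun F : {fset I} => \sum_(i <- F | i \in D) f i) @ totally)).
apply/cauchy_cvgP/cauchy_exP => e e0.
have [F0 F0e] := esum_tail (fun i => normr_ge0 (f i)) foo e0.
exists (\sum_(i <- F0 | i \in D) f i); exists F0 => // F /= F0F.
rewrite /ball /= distrC.
have -> : \sum_(i <- F | i \in D) f i - \sum_(i <- F0 | i \in D) f i =
    \sum_(i <- (F `\` F0)%fset | i \in D) f i.
  apply/eqP; rewrite subr_eq -[X in X == _]big_filter -[X in _ == X + _]big_filter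
    -[X in _ == _ + X]big_filter -big_cat; apply/eqP/perm_big/uniq_perm.
  - by rewrite filter_uniq ?fset_uniq.
  - rewrite cat_uniq !filter_uniq ?fset_uniq// andbT; apply/hasPn => i.
    by rewrite !mem_filter inE => /andP[_ ->]; rewrite andbF.
  move=> i; rewrite mem_cat !mem_filter inE -andb_orr; congr (_ && _).
  by case: (boolP (i \in F0)) => //= iF0; rewrite ?orbF// (fsubsetP F0F).
apply: le_lt_trans (ler_norm_sum _ _ _) _; apply: F0e => i.
by rewrite inE => /andP[].
Qed.
End Existence.

Lemma has_sumD (K : numFieldType) (I : choiceType) (D : set I) (f g : I -> K) (s t : K) :
  has_sum D f s -> has_sum D g t -> has_sum D (fun i => f i + g i) (s + t).
Proof.
rewrite /has_sum => fs gt; under eq_fun do rewrite big_split.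
exact: cvgD.
Qed.

Section Complex.
Context (R : realType).

Lemma normcC (z : R[i]) : (normc z)%:C%C = `|z|.
Proof. by case: z. Qed.

Lemma has_sum_real_complex (I : choiceType) (D : set I) (f : I -> R) (s : R) :
  has_sum D f s -> has_sum D (fun i => (f i)%:C%C) s%:C%C.
Proof.
move=> /has_sumP fs; apply/has_sumP => e e0.
case: e e0 => a b; rewrite ltcE /= => /andP[/eqP -> a0].
have [F0 F0e] := fs _ a0; exists F0 => F /F0e lt.
rewrite -rmorph_sum -rmorphB -normcC ltcR.
by rewrite /normc /= expr0n addr0 sqrtr_sqr.
Qed.

(** The real and imaginary parts are absolutely summable separately. *)
Lemma has_sum_complex (I : choiceType) (D : set I) (f : I -> R[i]) :
  abs_cvg D f -> exists s, has_sum D f s.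
Proof.
move=> foo.
have Re_le (z : R[i]) : `|complex.Re z| <= normc z.
  by case: z => a b /=; rewrite -sqrtr_sqr ler_sqrt ?lerDl ?addr_ge0 ?sqr_ge0.
have Im_le (z : R[i]) : `|complex.Im z| <= normc z.
  by case: z => a b /=; rewrite -sqrtr_sqr ler_sqrt ?lerDr ?addr_ge0 ?sqr_ge0.
have [a fa] : exists a, has_sum D (fun i => complex.Re (f i)) a.
  apply: has_sum_real; apply: le_lt_trans foo; apply: le_esum => i _.
  by rewrite lee_fin.
have [b fb] : exists a, has_sum D (fun i => complex.Im (f i)) a.
  apply: has_sum_real; apply: le_lt_trans foo; apply: le_esum => i _.
  by rewrite lee_fin.
exists (a%:C + 'i * b%:C)%C.
have := has_sumD (has_sum_real_complex fa) (@has_sumZ _ _ _ _ _ 'i%C (has_sum_real_complex fb)).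
by apply: eq_has_sum => i _; rewrite -complexE.
Qed.
End Complex.

(** * Powers of the sum of the variables *)

Section EvalMono.
Context (K : fieldType).
Implicit Types (x : nat -> K) (m n : cmonom nat).

Lemma eval_monoEw x n (d : {fset nat}) : (finsupp n `<=` d)%fset ->
  eval_mono x n = \prod_(i <- d) x i ^+ n i.
Proof.
move=> nd; apply: big_fset_incl => // i _.
by rewrite memNfinsupp => /eqP ->; rewrite expr0.
Qed.

Lemma eval_mono1 x : eval_mono x mone = 1.
Proof. by rewrite /eval_mono mdom1 big_seq_fset0. Qed.

Lemma eval_monoM x m n : eval_mono x (mmul m n) = eval_mono x m * eval_mono x n.
Proof.
rewrite /eval_mono mdomD -/(eval_mono x m) -/(eval_mono x n).
rewrite (eval_monoEw _ (fsubsetUl (finsupp m) (finsupp n))).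
rewrite (eval_monoEw _ (fsubsetUr (finsupp m) (finsupp n))) -big_split.
by apply: eq_bigr => i _; rewrite cmM exprD.
Qed.

Lemma eval_monoU x i : eval_mono x (ucm i) = x i.
Proof. by rewrite /eval_mono mdomU big_seq_fset1 cmUU. Qed.

Lemma eval_mono_pow x n k : eval_mono x (mpow n k) = eval_mono x n ^+ k.
Proof. by elim: k => [|k IH] /=; rewrite ?eval_mono1// eval_monoM IH exprS. Qed.

(** The monomial [x^m] counted once for each word with content [m], so that the
    weights of degree [d] add up to the [d]-th power of the sum of the
    variables. *)
Definition weight x m : K := (size (words m))%:R * eval_mono x m.

Lemma weight1 x : weight x mone = 1.
Proof.
by rewrite /weight eval_mono1 mulr1 /words /mword mdom1.
Qed.

Lemma size_words_rec m : m != mone ->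
  size (words m) = (\sum_(i <- finsupp m) size (words (divcm m (ucm i))))%N.
Proof.
move=> m1; apply/eqP; rewrite -(eqr_nat rat) natr_sum size_words multinomial_rec//.
by apply/eqP; apply: eq_bigr => i _; rewrite size_words.
Qed.

Lemma weight_rec x m : m != mone ->
  weight x m = \sum_(i <- finsupp m) x i * weight x (divcm m (ucm i)).
Proof.
move=> m1; rewrite /weight size_words_rec// natr_sum mulr_suml !big_seq.
apply: eq_bigr => i im; rewrite mulrCA; congr (_ * _).
by rewrite -{1}(cmonom_mulK im) eval_monoM eval_monoU.
Qed.
End EvalMono.

Section RealWeights.
Context (R : realType).

Lemma eval_mono_ge0 (r : nat -> R) m : (forall i, 0 <= r i) -> 0 <= eval_mono r m.
Proof. by move=> r0; apply: prodr_ge0 => i _; exact: exprn_ge0. Qed.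

Lemma weight_ge0 (r : nat -> R) m : (forall i, 0 <= r i) -> 0 <= weight r m.
Proof. by move=> r0; rewrite mulr_ge0// eval_mono_ge0. Qed.

Lemma esumZ (I : choiceType) (D : set I) (f : I -> R) (c : R) :
  (forall i, 0 <= f i) -> 0 <= c ->
  \esum_(i in D) (c * f i)%:E = (c%:E * \esum_(i in D) (f i)%:E)%E.
Proof.
have le (g : I -> R) (a : R) : (forall i, 0 <= g i) -> 0 <= a ->
    (\esum_(i in D) (a * g i)%:E <= a%:E * \esum_(i in D) (g i)%:E)%E.
  move=> g0 a0; apply: esum_le => F FD; rewrite -mulr_sumr EFinM.
  apply: lee_wpmul2l; first by rewrite lee_fin.
  apply: le_trans (sum_le_esum D g F); rewrite lee_fin le_eqVlt; apply/orP; left.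
  rewrite [X in _ == X]big_mkcond; apply/eqP/eq_big_seq => i iF.
  by rewrite mem_set//; exact: FD.
move=> f0; rewrite le_eqVlt => /orP[/eqP <-|c0].
  by rewrite mul0e esum1// => i _; rewrite mul0r.
apply/eqP; rewrite eq_le; apply/andP; split; first by apply: le => //; exact: ltW.
have ci0 : 0 < c^-1 by rewrite invr_gt0.
rewrite -(@lee_pmul2l _ c^-1%:E)// muleA -EFinM mulVf ?gt_eqF// mul1e.
apply: le_trans (le _ _ _ (ltW ci0)); last by move=> i; rewrite mulr_ge0// ltW.
by apply: le_esum => i _; rewrite mulrA mulVf ?gt_eqF// mul1r.
Qed.

Lemma esum_geometric (q : R) : 0 <= q < 1 ->
  \esum_(k in [set: nat]) (q ^+ k)%:E = ((1 - q)^-1)%:E.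
Proof.
move=> /andP[q0 q1]; rewrite -nneseries_esumT; last first.
  by move=> k; rewrite lee_fin exprn_ge0.
have -> : (fun k => \sum_(0 <= i < k) (q ^+ i)%:E)%E = EFin \o series (geometric 1 q).
  apply/funext => k; rewrite /= /series /= sumEFin; congr (_%:E).
  by apply: eq_bigr => i _; rewrite mul1r.
rewrite EFin_lim; last by apply: is_cvg_geometric_series; rewrite ger0_norm.
congr (_%:E); apply: cvg_lim => //.
by rewrite -[X in _ --> X]mul1r; apply: cvg_geometric_series; rewrite ger0_norm.
Qed.

Lemma esum_fset_seq (s : {fset nat}) (f : nat -> R) : (forall i, 0 <= f i) ->
  \esum_(i in [set` s]) (f i)%:E = (\sum_(i <- s) f i)%:E.
Proof.
move=> f0; rewrite esum_fset; last 2 first.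
  exact: finite_fset.
  by move=> i _; rewrite lee_fin.
by rewrite fsbig_finite//= set_fsetK sumEFin.
Qed.

Context (r : nat -> R) (rho : R).
Hypothesis r0 : forall i, 0 <= r i.
Hypothesis r_rho : \esum_(i in [set: nat]) (r i)%:E = rho%:E.

Lemma rho_ge0 : 0 <= rho.
Proof. by rewrite -lee_fin -r_rho esum_ge0// => i _; rewrite lee_fin. Qed.

(** The multinomial theorem in infinitely many nonnegative variables.  By
    [weight_rec], the weights of degree [d + 1] are a sum over monomials with a
    marked variable; these are the pairs of a variable and a monomial of
    degree [d]. *)
Lemma esum_weight_deg d :
  \esum_(m in [set m | mdeg m = d]) (weight r m)%:E = (rho ^+ d)%:E.
Proof.
elim: d => [|d IH].
  have -> : [set m : cmonom nat | mdeg m = 0%N] = [set mone].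
    by apply/seteqP; split => m /= => [/mdeg_eq0I|->]; rewrite ?mdeg1.
  by rewrite esum_set1 weight1.
have W i q : (0 <= (r i * weight r q)%:E)%E.
  by rewrite lee_fin mulr_ge0// weight_ge0.
transitivity (\esum_(m in [set m : cmonom nat | mdeg m = d.+1])
   \esum_(i in [set` finsupp m]) (r i * weight r (divcm m (ucm i)))%:E).
  apply: eq_esum => m /= md; rewrite weight_rec -?mdeg_eq0 ?md//.
  by rewrite (esum_fset_seq _ (fun i => mulr_ge0 (r0 i) (weight_ge0 _ r0))).
rewrite esum_esum//.
rewrite (reindex_esum ([set: nat] `*`` (fun=> [set m : cmonom nat | mdeg m = d])) _
  (fun p => (mmul (ucm p.1) p.2, p.1))); last first.
  split => [[i q] /= [_ qd]|[i q] [j q'] _ _ /= [+ ij]|[m i] /= [md im]].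
  - by rewrite mdegM mdegU qd -cmE_neq0 cmM cmUU.
  - rewrite ij => /(congr1 (fun m => divcm m (ucm j))) E; congr (_, _).
    apply: cmonomP => k; have := congr1 (fun m : cmonom nat => m k) E.
    by rewrite !divcmE !cmM !addKn.
  exists (i, divcm m (ucm i)); last by rewrite /= cmonom_mulK.
  by split=> //=; apply/succn_inj; rewrite -mdeg_div_ucm.
transitivity (\esum_(i in [set: nat]) \esum_(q in [set m : cmonom nat | mdeg m = d])
   (r i * weight r q)%:E).
  rewrite esum_esum//; apply: eq_esum => -[i q] /= _; congr (_ * weight r _)%:E.
  by apply: cmonomP => k; rewrite divcmE cmM addKn.
transitivity (\esum_(i in [set: nat]) (rho ^+ d * r i)%:E).
  apply: eq_esum => i _; rewrite esumZ//; last by move=> q; exact: weight_ge0.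
  by rewrite IH -EFinM mulrC.
by rewrite esumZ ?exprn_ge0 ?rho_ge0// r_rho -EFinM -exprSr.
Qed.

(** Grouping by degree leaves a geometric series. *)
Lemma esum_weight_ge N : rho < 1 ->
  \esum_(m in [set m | (N <= mdeg m)%N]) (weight r m)%:E = (rho ^+ N / (1 - rho))%:E.
Proof.
move=> rho1.
transitivity (\esum_(d in [set d | (N <= d)%N])
   \esum_(m in [set m | mdeg m = d]) (weight r m)%:E).
  rewrite esum_esum; last by move=> d m _ _; rewrite lee_fin weight_ge0.
  rewrite (reindex_esum [set m | (N <= mdeg m)%N] _ (fun m => (mdeg m, m)))//.
  split => [m|m n _ _ [_ //]|[d m] /= [dN md]] //=; by exists m; rewrite ?md.
transitivity (\esum_(d in [set d | (N <= d)%N]) (rho ^+ d)%:E).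
  by apply: eq_esum => d _; exact: esum_weight_deg.
rewrite (reindex_esum [set: nat] _ (fun d => N + d)%N); last first.
  split => [d _ /=|d e _ _ /addnI//|d /= Nd]; first exact: leq_addr.
  by exists (d - N)%N; rewrite ?subnKC.
transitivity (\esum_(d in [set: nat]) (rho ^+ N * rho ^+ d)%:E).
  by apply: eq_esum => d _; rewrite exprD.
rewrite esumZ ?exprn_ge0 ?rho_ge0// ?esum_geometric ?rho_ge0//.
by move=> d; rewrite exprn_ge0// rho_ge0.
Qed.

(** A monomial is at most its weight, which is one term of the sum in its degree. *)
Lemma eval_mono_le_deg m : eval_mono r m <= rho ^+ mdeg m.
Proof.
apply: (@le_trans _ _ (weight r m)).
  rewrite /weight ler_peMl ?eval_mono_ge0// ler1n -has_predT.
  by apply/hasP; exists (mword m) => //; apply/mem_words => i; exact: count_mword.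
rewrite -lee_fin -esum_weight_deg.
apply: esum_ge; exists [set m]; first by split => // n ->.
by rewrite fsbig_set1.
Qed.
End RealWeights.

(** * The sum of the logarithms *)

Lemma has_sum_inj (K : numFieldType) (I J : choiceType) (D : set I) (h : I -> J)
    (f : J -> K) (s : K) : injective h ->
  has_sum D (f \o h) s -> has_sum (h @` D) f s.
Proof.
move=> hI fs; apply: (has_sum_fibers (p := h) _ fs) => [i Di|j [i Di <-]]; first by exists i.
have -> : f (h i) = \sum_(k <- [:: i]) (f \o h) k by rewrite big_seq1.
apply: has_sum_seq => // [k|k [_ /= /hI ->]]; rewrite inE.
  by move=> /eqP ->.
by rewrite eqxx.
Qed.

Section ComplexSums.
Context (R : realType).
Implicit Types (x : nat -> R[i]) (w : R[i]).

Lemma normcX w k : normc (w ^+ k) = normc w ^+ k.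
Proof. by elim: k => [|k IH]; rewrite ?expr0 ?normc1// !exprS normcM IH. Qed.

Lemma normc_nat k : normc (k%:R : R[i]) = k%:R.
Proof. by rewrite normcMn normc1. Qed.

Lemma normc_ge0 w : 0 <= normc w.
Proof. by case: w => a b; exact: sqrtr_ge0. Qed.

Lemma normc_eval_mono x n : normc (eval_mono x n) = eval_mono (fun i => normc (x i)) n.
Proof.
rewrite /eval_mono (big_morph _ (@normcM R) (@normc1 R)).
by apply: eq_bigr => i _; exact: normcX.
Qed.

Lemma normc_weight x n : normc (weight x n) = weight (fun i => normc (x i)) n.
Proof. by rewrite /weight normcM normc_nat normc_eval_mono. Qed.

(** The closed disk of radius [M] contains all finite partial sums. *)
Lemma has_sum_normc_le (I : choiceType) (D : set I) (f : I -> R[i]) s (M : R) :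
  has_sum D f s -> (\esum_(i in D) (normc (f i))%:E <= M%:E)%E -> normc s <= M.
Proof.
move=> /has_sumP fs fM; rewrite leNgt; apply/negP => Ms.
have e0 : 0 < (normc s - M)%:C%C by rewrite ltcR subr_gt0.
have [F /(_ F (fsubset_refl _))] := fs _ e0.
set S := \sum_(i <- F | _) _; rewrite -normcC ltcR.
have SM : normc S <= M.
  rewrite -lee_fin; apply: le_trans fM; apply: le_trans (sum_le_esum _ _ F).
  rewrite lee_fin -lecR normcC rmorph_sum; apply: le_trans (ler_norm_sum _ _ _) _.
  by apply: ler_sum => i _; rewrite -normcC.
have := le_normcD (s - S) S; rewrite subrK; lra.
Qed.

Lemma esum_log_le w : normc w < 1 ->
  (\esum_(k in [set: nat]) (normc (w ^+ k.+1 / k.+1%:R))%:E <=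
     (normc w / (1 - normc w))%:E)%E.
Proof.
move=> w1; rewrite EFinM -esum_geometric ?normc_ge0// -esumZ ?normc_ge0//; last first.
  by move=> k; rewrite exprn_ge0// normc_ge0.
apply: le_esum => k _; rewrite lee_fin normcM normcV normc_nat normcX -exprS.
by rewrite ler_piMr ?exprn_ge0 ?normc_ge0// invf_le1 ?ler1n.
Qed.

Lemma has_sum_log w : normc w < 1 ->
  has_sum [set: nat] (fun k => w ^+ k.+1 / k.+1%:R) (- log1m w).
Proof.
move=> w1; have [s ws] : exists s, has_sum [set: nat] (fun k => w ^+ k.+1 / k.+1%:R) s.
  by apply: has_sum_complex; exact: le_lt_trans (esum_log_le w1) (ltry _).
by rewrite /log1m opprK (has_sum_series ws).
Qed.

Lemma normc_log_le w : normc w < 1 -> normc (log1m w) <= normc w / (1 - normc w).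
Proof.
by move=> w1; rewrite -normcN; apply: has_sum_normc_le (has_sum_log w1) (esum_log_le w1).
Qed.

Context (x : nat -> R[i]) (rho : R).
Let r i := normc (x i).
Hypothesis x_rho : \esum_(i in [set: nat]) (r i)%:E = rho%:E.

Let r0 i : 0 <= r i := normc_ge0 (x i).

Lemma has_sum_vars : has_sum [set: nat] x (series_sum x).
Proof.
have [s xs] : exists s, has_sum [set: nat] x s.
  by apply: has_sum_complex; rewrite /abs_cvg -/r x_rho ltry.
by rewrite /series_sum (has_sum_series xs).
Qed.

Lemma normc_series_sum_le : normc (series_sum x) <= rho.
Proof. by apply: has_sum_normc_le has_sum_vars _; rewrite -x_rho. Qed.

(** As in [esum_weight_deg], the induction step sums over the pairs of a variable
    and a monomial of degree [d].  For a fixed monomial, summing over the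
    variable gives a factor [series_sum x]; for a fixed product of the two, the
    pairs are finite in number and [weight_rec] adds them up. *)
Lemma has_sum_weight d :
  has_sum [set m | mdeg m = d] (weight x) (series_sum x ^+ d).
Proof.
elim: d => [|d IH].
  have -> : series_sum x ^+ 0 = \sum_(m <- [:: mone]) weight x m.
    by rewrite big_seq1 weight1.
  apply: has_sum_seq => //= m; rewrite inE; first by move=> /eqP ->; rewrite mdeg1.
  by move=> /mdeg_eq0I ->; rewrite eqxx.
pose f (j : nat * cmonom nat) := x j.1 * weight x j.2.
pose D := [set j : nat * cmonom nat | mdeg j.2 = d].
have [s fs] : exists s, has_sum D f s.
  apply: has_sum_complex; rewrite /abs_cvg.
  have -> : D = [set: nat] `*`` (fun=> [set m : cmonom nat | mdeg m = d]).
    by apply/seteqP; split => [[i q]|[i q] []].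
  have W i q : 0 <= r i * weight r q by rewrite mulr_ge0// weight_ge0.
  rewrite (eq_esum (b := fun j => (r j.1 * weight r j.2)%:E)); last first.
    by move=> j _; rewrite /f normcM normc_weight.
  rewrite -(esum_esum (a := fun i q => (r i * weight r q)%:E)); last first.
    by move=> i q _ _; rewrite lee_fin.
  rewrite (eq_esum (b := fun i => (rho ^+ d * r i)%:E)); last first.
    move=> i _; rewrite esumZ ?(esum_weight_deg r0 x_rho)// -?EFinM 1?mulrC//.
    by move=> q; exact: weight_ge0.
  by rewrite esumZ ?exprn_ge0 ?(rho_ge0 r0 x_rho)// x_rho -EFinM ltry.
have fX : has_sum [set m : cmonom nat | mdeg m = d] (fun m => series_sum x * weight x m) s.
  have DE j : D j -> [set m : cmonom nat | mdeg m = d] j.2 by [].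
  apply: (@has_sum_fibers _ _ _ _ _ snd _ _ _ DE fs) => q qd.
  have -> : D `&` [set j | j.2 = q] = (fun i => (i, q)) @` [set: nat].
    by apply/seteqP; split => [[i q'] [_ /= ->]|_ [i _ <-]] //=; exists i.
  apply: has_sum_inj; first by move=> i j [].
  rewrite mulrC; have := @has_sumZ _ _ _ _ _ (weight x q) has_sum_vars.
  by apply: eq_has_sum => i _; rewrite mulrC.
have -> : series_sum x ^+ d.+1 = s.
  by apply: has_sum_unique fX; rewrite exprS; exact: has_sumZ.
apply: (has_sum_fibers (p := fun j => mmul (ucm j.1) j.2) _ fs) => [[i q] /=|m /= md].
  by move=> qd; rewrite mdegM mdegU qd.
have m1 : m != mone by rewrite -mdeg_eq0 md.
rewrite (weight_rec x m1).
pose s0 := [seq (i, divcm m (ucm i)) | i <- finsupp m].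
rewrite -[X in has_sum _ _ X](big_map (fun i => (i, divcm m (ucm i))) xpredT f) -/s0.
apply: has_sum_seq.
- by rewrite map_inj_uniq ?fset_uniq// => i j [].
- move=> _ /mapP[i im ->] /=; split; last exact: cmonom_mulK.
  by apply/succn_inj; rewrite -mdeg_div_ucm.
move=> [i q] [/= qd iq]; case/negP; apply/mapP; exists i.
  by rewrite -iq -cmE_neq0 cmM cmUU.
by congr (_, _); apply: cmonomP => k; rewrite -iq divcmE cmM addKn.
Qed.

(** In [sum_coef] every summand is nonnegative, being an orbit count divided by
    [k]; the summand [k = 1] is [coef n]. *)
Lemma coef_bound n : n != mone ->
  exists2 k : nat, coef n = k%:R & (k <= size (words n))%N.
Proof.
move=> n1; have [k ck _] := coef_full_orbits n1; exists k => //.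
have g0 := mgcd_gt0 n1.
have := sum_coef n1; rewrite (bigD1_seq 1%N) ?divisors_uniq -?dvdn_divisors ?dvd1n//=.
have -> : mquo n 1 = n by apply: cmonomP => i; rewrite mquoE divn1.
rewrite divr1 ck -size_words => E.
rewrite -(ler_nat rat); apply: (@le_trans _ _ ((size (words n))%:R / (mdeg n)%:R)); last first.
  by rewrite ler_piMr// invf_le1 ?ler1n ?ltr0n lt0n mdeg_eq0.
rewrite -E lerDl big_seq_cond sumr_ge0// => d /andP[].
rewrite -dvdn_divisors// => dn _.
by have [l -> _] := coef_full_orbits (mquo_neq1 n1 dn); rewrite divr_ge0.
Qed.

Lemma normc_coef_le n : n != mone ->
  normc (ratr (coef n) : R[i]) <= (size (words n))%:R.
Proof.
by move=> /coef_bound[k -> ks]; rewrite ratr_nat normc_nat ler_nat.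
Qed.

Hypothesis rho1 : rho < 1.

Let rho_ge : 0 <= rho := rho_ge0 r0 x_rho.

Lemma normc_eval_mono_le n : n != mone -> normc (eval_mono x n) <= rho.
Proof.
move=> n1; rewrite normc_eval_mono.
apply: le_trans (eval_mono_le_deg r0 x_rho n) _.
by apply: ler_iXnr => //; [rewrite lt0n mdeg_eq0|exact: ltW].
Qed.

(** All the expanded logarithms as one family; the exponent is shifted, so that
    the index [(n, k)] stands for the power [k + 1] of [x^n]. *)
Definition log_family (j : cmonom nat * nat) : R[i] :=
  ratr (coef j.1) * (eval_mono x j.1 ^+ j.2.+1 / j.2.+1%:R).

Definition log_indices : set (cmonom nat * nat) := [set j | j.1 != mone].

(** Since [|x^n| <= rho], the terms are at most [weight r n * rho ^+ k]. *)
Lemma abs_cvg_log_family : abs_cvg log_indices log_family.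
Proof.
rewrite /abs_cvg.
have -> : log_indices = nonzero_exponents `*`` (fun=> [set: nat]).
  by apply/seteqP; split => [[n k]|[n k] []].
have W n k : 0 <= weight r n * rho ^+ k by rewrite mulr_ge0 ?exprn_ge0// weight_ge0.
apply: (@le_lt_trans _ _ (\esum_(j in nonzero_exponents `*`` (fun=> [set: nat]))
    (weight r j.1 * rho ^+ j.2)%:E)).
  apply: le_esum => -[n k] /= [n1 _]; rewrite lee_fin /log_family /=.
  have := normc_coef_le n1; move: (ratr (coef n) : R[i]) => c cn.
  rewrite normcM [normc (_ / _)]normcM normcV normc_nat normcX.
  rewrite /weight -normc_eval_mono exprS.
  rewrite -!mulrA ler_pM ?normc_ge0 ?mulr_ge0 ?invr_ge0 ?exprn_ge0 ?normc_ge0//.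
  rewrite ler_wpM2l ?normc_ge0//.
  rewrite (@le_trans _ _ (normc (eval_mono x n) ^+ k))//.
    by rewrite ler_piMr ?exprn_ge0 ?normc_ge0// invf_le1 ?ler1n.
  by rewrite lerXn2r ?nnegrE ?normc_ge0// normc_eval_mono_le.
rewrite -(esum_esum (a := fun n k => (weight r n * rho ^+ k)%:E)); last first.
  by move=> n k _ _; rewrite lee_fin.
rewrite (eq_esum (b := fun n => ((1 - rho)^-1 * weight r n)%:E)); last first.
  move=> n _; rewrite esumZ ?weight_ge0//; last by move=> k; exact: exprn_ge0.
  by rewrite esum_geometric ?rho_ge// -EFinM mulrC.
have -> : nonzero_exponents = [set n | (1 <= mdeg n)%N].
  by apply/seteqP; split => n /=; rewrite /nonzero_exponents /= -mdeg_eq0 lt0n.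
rewrite esumZ ?invr_ge0 ?subr_ge0 ?(ltW rho1)//; last by move=> n; exact: weight_ge0.
by rewrite (esum_weight_ge r0 x_rho)// -EFinM ltry.
Qed.

Lemma has_sum_log_family_fst n : n != mone ->
  has_sum (log_indices `&` [set j | j.1 = n]) log_family (- term x n).
Proof.
move=> n1.
have -> : log_indices `&` [set j | j.1 = n] = (fun k => (n, k)) @` [set: nat].
  by apply/seteqP; split => [[q k] [_ /= ->]|_ [k _ <-]] //=; exists k.
apply: has_sum_inj; first by move=> i j [].
rewrite /term -mulrN; apply: has_sumZ; apply: has_sum_log.
exact: le_lt_trans (normc_eval_mono_le n1) rho1.
Qed.

(** The fibre is finite, indexed by the divisors of [mgcd m], and [sum_coef]
    evaluates its sum. *)
Lemma has_sum_log_family_mpow m : m != mone ->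
  has_sum (log_indices `&` [set j | mpow j.1 j.2.+1 = m]) log_family
    (weight x m / (mdeg m)%:R).
Proof.
move=> m1; have g0 := mgcd_gt0 m1.
pose s0 := [seq (mquo m k, k.-1) | k <- divisors (mgcd m)].
have -> : weight x m / (mdeg m)%:R = \sum_(j <- s0) log_family j.
  rewrite big_map /weight mulrAC -(ratr_nat R[i] (size _)) -ratr_div_nat size_words.
  rewrite -sum_coef// rmorph_sum mulr_suml !big_seq; apply: eq_bigr => k.
  rewrite -dvdn_divisors// => km; have k0 := dvdn_gt0 g0 km.
  rewrite /log_family /= prednK// -eval_mono_pow mpow_mquo// [LHS]mulrC.
  by rewrite [in LHS]ratr_div_nat mulrCA mulrA.
apply: has_sum_seq.
- rewrite map_inj_in_uniq ?divisors_uniq// => k l; rewrite -!dvdn_divisors// => km lm.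
  move=> /(congr1 snd) /= kl.
  by rewrite -[LHS](prednK (dvdn_gt0 g0 km)) -[RHS](prednK (dvdn_gt0 g0 lm)) kl.
- move=> _ /mapP[k + ->]; rewrite -dvdn_divisors// => km.
  split; first exact: mquo_neq1.
  have -> : [set j : cmonom nat * nat | mpow j.1 j.2.+1 = m] (mquo m k, k.-1) =
    (mpow (mquo m k) k.-1.+1 = m) by [].
  by rewrite prednK ?(dvdn_gt0 g0 km)// mpow_mquo.
move=> [n k] [n1 nm]; have {}nm : mpow n k.+1 = m := nm.
case/negP; apply/mapP; exists k.+1.
  by rewrite -dvdn_divisors// -nm dvd_mgcd_mpow.
by rewrite -nm mquo_mpow.
Qed.

(** Grouping the family by index, and grouping it by monomial and then by
    degree, must give the same sum. *)
Lemma has_sum_term : has_sum nonzero_exponents (term x) (log1m (series_sum x)).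
Proof.
have [s fs] := has_sum_complex abs_cvg_log_family.
have ts : has_sum nonzero_exponents (fun n => - term x n) s.
  have DE j : log_indices j -> nonzero_exponents j.1 by [].
  exact: (@has_sum_fibers _ _ _ _ _ fst _ _ _ DE fs has_sum_log_family_fst).
have ms : has_sum nonzero_exponents (fun m => weight x m / (mdeg m)%:R) s.
  have DE j : log_indices j -> nonzero_exponents (mpow j.1 j.2.+1).
    by move=> j1; exact: mpow_eq1.
  exact: (@has_sum_fibers _ _ _ _ _ _ _ _ _ DE fs has_sum_log_family_mpow).
have ds : has_sum [set: nat] (fun d => series_sum x ^+ d.+1 / d.+1%:R) s.
  (* Degrees are shifted by one to match the indices of the logarithmic series. *)
  have DE m : nonzero_exponents m -> [set: nat] (mdeg m).-1 by [].
  apply: (@has_sum_fibers _ _ _ _ _ _ _ _ _ DE ms) => d _.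
  have -> : nonzero_exponents `&` [set m | (mdeg m).-1 = d] = [set m | mdeg m = d.+1].
    apply/seteqP; split => m; rewrite /nonzero_exponents /= -mdeg_eq0.
      by move=> [m1 <-]; rewrite prednK// lt0n.
    by move=> ->.
  rewrite [X in has_sum _ _ X]mulrC.
  have := @has_sumZ _ _ _ _ _ (d.+1%:R^-1) (has_sum_weight (d := d.+1)).
  by apply: eq_has_sum => m /= md; rewrite md mulrC.
have X1 : normc (series_sum x) < 1 := le_lt_trans normc_series_sum_le rho1.
have sE : s = - log1m (series_sum x) := has_sum_unique ds (has_sum_log X1).
have := @has_sumZ _ _ _ _ _ (-1) ts; rewrite sE mulN1r opprK.
by apply: eq_has_sum => n _; rewrite mulN1r opprK.
Qed.
End ComplexSums.

(** * Absolute and uniform convergence *)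

Section Bounds.
Context (R : realType).

Lemma esum_subset (I : choiceType) (A B : set I) (f : I -> R) : A `<=` B ->
  (\esum_(i in A) (f i)%:E <= \esum_(i in B) (f i)%:E)%E.
Proof.
move=> AB; apply: esum_le => F FA; apply: le_trans (sum_le_esum _ _ F).
rewrite lee_fin [X in _ <= X]big_mkcond le_eqVlt; apply/orP; left.
by apply/eqP/eq_big_seq => i iF; rewrite mem_set//; apply/AB/FA.
Qed.

(** Every such monomial other than 1 is a variable of [F] times a monomial of
    smaller degree. *)
Lemma finite_bounded_monomials (F : {fset nat}) N :
  finite_set [set m : cmonom nat | (finsupp m `<=` F)%fset /\ (mdeg m < N)%N].
Proof.
elim: N => [|N IH]; first by apply: (@sub_finite_set _ _ set0) => // m [].
apply: (@sub_finite_set _ _ ([set mone] `|`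
  (fun p : nat * cmonom nat => mmul (ucm p.1) p.2) @` ([set` F] `*`
   [set m : cmonom nat | (finsupp m `<=` F)%fset /\ (mdeg m < N)%N]))); last first.
  rewrite finite_setU; split; first exact: finite_set1.
  by apply/finite_image/finite_setX => //; exact: finite_fset.
move=> m [/fsubsetP mF mN]; have [->|m1] := eqVneq m mone; first by left.
right; have [i mi] := cmonom_neq1P m1.
have im : i \in finsupp m by rewrite -cmE_neq0 -lt0n.
exists (i, divcm m (ucm i)); last exact: cmonom_mulK.
split=> /=; first exact: mF.
split; last by rewrite (mdeg_div_ucm im) in mN.
apply/fsubsetP => j; rewrite -cmE_neq0 divcmE => mj; apply: mF.
by rewrite -cmE_neq0; apply: contraNneq mj => ->; rewrite sub0n.
Qed.

Section Tails.
Context (r : nat -> R) (rho : R).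
Hypothesis r0 : forall i, 0 <= r i.
Hypothesis r_rho : \esum_(i in [set: nat]) (r i)%:E = rho%:E.
Context (e : R).
Hypothesis e0 : 0 < e.
Hypothesis rho_e : rho < 1 - e.

Let rho1 : rho < 1.
Proof. by move: e0 rho_e; lra. Qed.

Let rho_ge : 0 <= rho := rho_ge0 r0 r_rho.

Lemma esum_weight_ge_le N :
  (\esum_(m in [set m | (N <= mdeg m)%N]) (weight r m)%:E <= ((1 - e) ^+ N / e)%:E)%E.
Proof.
rewrite (esum_weight_ge r0 r_rho)// lee_fin.
have e1 : 0 < 1 - rho by rewrite subr_gt0.
apply: ler_pM.
- exact: exprn_ge0.
- by rewrite invr_ge0 ltW.
- by rewrite lerXn2r ?nnegrE ?(ltW rho_e)//; exact: le_trans (ltW rho_e).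
- by rewrite lef_pV2 ?posrE//; move: rho_e; lra.
Qed.

(** Setting the variables outside [F] to zero keeps exactly the weights of the
    monomials supported in [F], so the others add up to
    [1 / (1 - rho) - 1 / (1 - rhoF)], with [rhoF] the sum over [F].  Both
    denominators are larger than [e], and [rho - rhoF <= eta]. *)
Lemma esum_weight_outside (F : {fset nat}) (eta : R) :
  (\esum_(i in ~` [set` F]) (r i)%:E <= eta%:E)%E ->
  (\esum_(m in [set m : cmonom nat | ~~ (finsupp m `<=` F)%fset]) (weight r m)%:E
    <= (eta / e ^+ 2)%:E)%E.
Proof.
move=> rF; pose rhoF := \sum_(i <- F) r i.
pose rr i := if i \in F then r i else 0.
have rr0 i : 0 <= rr i by rewrite /rr; case: ifP.
have rr_rho : \esum_(i in [set: nat]) (rr i)%:E = rhoF%:E.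
  rewrite -esum_fset_seq// [RHS]esum_mkcond; apply: eq_esum => i _.
  by rewrite mem_setE /rr; case: ifP.
have rF0 : 0 <= rhoF by exact: sumr_ge0.
have rho_eta : rho - rhoF <= eta.
  have := esumID [set` F] [set: nat] (fun i => (r i)%:E) (fun i _ => r0 i).
  rewrite !setTI r_rho esum_fset_seq//; move: rF.
  case: (esum _ _) => [s||]// seta E.
  move: seta; rewrite !lee_fin.
  by move: E => /eqP; rewrite -EFinD eqe => /eqP ->; rewrite addrC addKr.
have rhoF_rho : rhoF <= rho.
  rewrite -lee_fin -r_rho -esum_fset_seq//; exact: esum_subset.
have weightF m : weight rr m = if (finsupp m `<=` F)%fset then weight r m else 0.
  rewrite /weight /eval_mono; case: ifPn => [/fsubsetP mF|].
    congr (_ * _); apply: eq_big_seq => i im.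
    by rewrite /rr mF.
  move=> /fsubsetPn[i im iF].
  rewrite (big_fsetD1 i)//= /rr (negPf iF) expr0n.
  by move: im; rewrite -cmE_neq0 => /negPf ->; rewrite mul0r mulr0.
have degT : [set m : cmonom nat | (0 <= mdeg m)%N] = [set: cmonom nat].
  by apply/seteqP; split.
have W : \esum_(m in [set: cmonom nat]) (weight r m)%:E = ((1 - rho)^-1)%:E.
  by rewrite -degT (esum_weight_ge r0 r_rho)// expr0 mul1r.
have WF : \esum_(m in [set: cmonom nat]) (weight rr m)%:E = ((1 - rhoF)^-1)%:E.
  by rewrite -degT (esum_weight_ge rr0 rr_rho) ?expr0 ?mul1r//; exact: le_lt_trans rho1.
have := esumID [set m : cmonom nat | (finsupp m `<=` F)%fset] [set: cmonom nat]
   (fun m => (weight r m)%:E) (fun m _ => weight_ge0 m r0).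
rewrite !setTI W.
have -> : \esum_(m in [set m : cmonom nat | (finsupp m `<=` F)%fset]) (weight r m)%:E =
    ((1 - rhoF)^-1)%:E.
  rewrite -WF [LHS]esum_mkcond; apply: eq_esum => m _.
  rewrite weightF; case: ifPn => [/set_mem /= -> //|/negP nm].
  by rewrite ifN//; apply/negP => mF; apply: nm; exact: mem_set.
have -> : ~` [set m : cmonom nat | (finsupp m `<=` F)%fset] =
   [set m : cmonom nat | ~~ (finsupp m `<=` F)%fset].
  by apply/seteqP; split => m /= /negP.
case: (esum _ _) => [s||]// /eqP; rewrite -EFinD eqe => /eqP E.
rewrite lee_fin.
have a0 : 0 < 1 - rho by rewrite subr_gt0.
have b0 : 0 < 1 - rhoF by move: rhoF_rho rho1; lra.
have -> : s = (rho - rhoF) / ((1 - rho) * (1 - rhoF)).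
  have -> : s = (1 - rho)^-1 - (1 - rhoF)^-1 by rewrite E; ring.
  by field; rewrite !gt_eqF.
apply: ler_pM => //; rewrite ?subr_ge0 ?invr_ge0 ?mulr_ge0 ?(ltW a0) ?(ltW b0)//.
rewrite lef_pV2 ?posrE ?mulr_gt0 ?exprn_gt0// expr2.
apply: ler_pM; rewrite ?(ltW e0)//; move: rhoF_rho rho_e; lra.
Qed.
End Tails.

Lemma regionP (e : R) (x : nat -> R[i]) : region e x ->
  exists2 rho, \esum_(i in [set: nat]) (normc (x i))%:E = rho%:E & rho < 1 - e.
Proof.
rewrite /region /= nneseries_esumT; last by move=> i; rewrite lee_fin normc_ge0.
have : (0 <= \esum_(i in [set: nat]) (normc (x i))%:E)%E.
  by apply: esum_ge0 => i _; rewrite lee_fin normc_ge0.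
by case: (esum _ _) => [rho||]// _; rewrite lte_fin; exists rho.
Qed.

(** In the region, [1 - |x^n| > e]. *)
Lemma normc_term_le (e : R) (x : nat -> R[i]) n : 0 < e -> region e x -> n != mone ->
  normc (term x n) <= e^-1 * weight (fun i => normc (x i)) n.
Proof.
move=> e0 /regionP[rho x_rho rho_e] n1.
have rho1 : rho < 1 by move: e0 rho_e; lra.
have wr := normc_eval_mono_le x_rho rho1 n1.
rewrite /term normcM; have := normc_coef_le R n1.
move: (ratr (coef n) : R[i]) => c cn.
rewrite [leRHS]mulrC /weight -normc_eval_mono -mulrA; apply: ler_pM; rewrite ?normc_ge0//.
apply: le_trans (normc_log_le _) _; first exact: le_lt_trans rho1.
apply: ler_pM; rewrite ?normc_ge0 ?invr_ge0 ?subr_ge0//.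
  by apply: le_trans wr _; exact: ltW.
by rewrite lef_pV2 ?posrE//; move: wr rho_e e0; lra.
Qed.

Lemma esum_term_le (e : R) (x : nat -> R[i]) (A : set (cmonom nat)) :
  0 < e -> region e x -> A `<=` nonzero_exponents ->
  (\esum_(n in A) (normc (term x n))%:E <=
   e^-1%:E * \esum_(n in A) (weight (fun i => normc (x i)) n)%:E)%E.
Proof.
move=> e0 xe AD; rewrite -esumZ ?invr_ge0 ?(ltW e0)//; last first.
  by move=> n; apply: weight_ge0 => i; exact: normc_ge0.
by apply: le_esum => n /AD n1; rewrite lee_fin normc_term_le.
Qed.

Lemma expr_small (q d : R) : 0 <= q < 1 -> 0 < d -> exists N, q ^+ N <= d.
Proof.
move=> /andP[q0 q1] d0.
have : (fun n => q ^+ n) @ \oo --> 0 by apply: cvg_expr; rewrite ger0_norm.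
move=> /cvgrPdist_lt/(_ _ d0)[N _ /(_ N (leqnn N))].
by rewrite sub0r normrN ger0_norm ?exprn_ge0// => /ltW; exists N.
Qed.
End Bounds.

(** The majorants of [normc_term_le] reduce both kinds of uniform convergence to
    tails of the sum of the weights. *)
Lemma analytic_identity (R : realType) (e : R) : 0 < e ->
        [/\ forall x : nat -> R[i], region e x ->
              abs_cvg nonzero_exponents (term x) /\
              (exists2 s : R[i], has_sum nonzero_exponents (term x) s &
                - log1m (series_sum x) = - s),
            abs_unif_cvg_deg (@mdeg nat) nonzero_exponents (region e) (@term R)
          & forall S : set (nat -> R[i]), S `<=` region e ->
              abs_unif_cvg [set: nat] S (fun x i => x i) ->
              abs_unif_cvg nonzero_exponents S (@term R)].
Proof.
move=> e0.
have nc0 (x : nat -> R[i]) i : 0 <= normc (x i) := normc_ge0 (x i).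
have small (d : R) : 0 < d -> exists N, forall x : nat -> R[i], region e x ->
    (\esum_(m in [set m | (N <= mdeg m)%N]) (weight (fun i => normc (x i)) m)%:E
      <= d%:E)%E.
  move=> d0; have [e1|e1] := leP 1 e.
    (* For e >= 1 the region is empty. *)
    exists 0%N => x /regionP[rho x_rho rho_e].
    by have := rho_ge0 (nc0 x) x_rho; rewrite leNgt (lt_le_trans rho_e)// subr_le0.
  have [||N Nd] := @expr_small _ (1 - e) (d * e); rewrite ?mulr_gt0//.
    by rewrite subr_ge0 ltW//= gtrBl.
  exists N => x /regionP[rho x_rho rho_e].
  apply: le_trans (esum_weight_ge_le (nc0 x) x_rho e0 rho_e N) _.
  by rewrite lee_fin ler_pdivrMr.
have ei : (0 <= e^-1%:E)%E by rewrite lee_fin invr_ge0 ltW.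
split.
- move=> x xe; have [rho x_rho rho_e] := regionP xe.
  have rho1 : rho < 1 by rewrite (lt_trans rho_e)// gtrBl.
  split; last by exists (log1m (series_sum x)) => //; exact: has_sum_term x_rho rho1.
  apply: le_lt_trans (esum_term_le e0 xe (@subset_refl _ _)) _.
  have le := esum_weight_ge_le (nc0 x) x_rho e0 rho_e 0.
  apply: (@le_lt_trans _ _ (e^-1%:E * ((1 - e) ^+ 0 / e)%:E)%E); last by rewrite -EFinM ltry.
  apply: lee_wpmul2l => //; apply: le_trans le.
  exact: esum_subset.
- move=> d d0; have [N Nd] := small _ (mulr_gt0 e0 d0); exists N => x xe.
  apply: le_trans (esum_term_le e0 xe _) _; first by move=> n [].
  apply: (@le_trans _ _ (e^-1%:E * (e * d)%:E)%E); last first.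
    by rewrite -EFinM mulKf ?gt_eqF.
  apply: lee_wpmul2l => //; apply: le_trans (Nd _ xe).
  by apply: esum_subset => n [].
move=> S Se Su d d0.
(* Half of e * d is spent on the degrees from N on; the other half, multiplied
   by the e ^+ 2 lost in esum_weight_outside, on the variables outside F. *)
have d2 : 0 < e * d / 2 by rewrite divr_gt0// mulr_gt0.
have [N Nd] := small _ d2.
have eta0 : 0 < e * d / 2 * e ^+ 2 by rewrite mulr_gt0// exprn_gt0.
have [F Fd] := Su _ eta0.
exists (fset_set [set m : cmonom nat | (finsupp m `<=` F)%fset /\ (mdeg m < N)%N]) => x Sx.
have xe := Se _ Sx; have [rho x_rho rho_e] := regionP xe.
apply: le_trans (esum_term_le e0 xe _) _; first by move=> n [].
apply: (@le_trans _ _ (e^-1%:E * (e * d / 2 + e * d / 2)%:E)%E); last first.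
  by rewrite -splitr -EFinM mulKf ?gt_eqF.
apply: lee_wpmul2l => //.
rewrite (esumID [set m : cmonom nat | (N <= mdeg m)%N]); last first.
  by move=> n _; rewrite lee_fin weight_ge0.
rewrite EFinD; apply: leeD.
  by apply: le_trans (Nd _ xe); apply: esum_subset => n [].
have : (\esum_(i in ~` [set` F]) (normc (x i))%:E <= (e * d / 2 * e ^+ 2)%:E)%E.
  apply: le_trans (Fd _ Sx); by apply: esum_subset.
move=> /(esum_weight_outside (nc0 x) x_rho e0 rho_e).
rewrite mulfK ?gt_eqF ?exprn_gt0//; apply: le_trans.
apply: esum_subset => m [[m1 /= nm] /negP]; rewrite -ltnNge => mN.
apply/negP => mF; apply: nm; rewrite in_fset_set; last exact: finite_bounded_monomials.
by rewrite mem_set.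
Qed.

Theorem theorem14p1 (R : realType) :
  [/\ (* equivalence of (i) and (ii); in particular c_n is in N *)
      forall n : cmonom nat, nonzero_exponents n ->
        exists2 k : nat, coef n = k%:R & (full_orbits n #= `I_k)%card,
      (* the identity in C[[x_0, x_1, ...]] *)
      fps_summable nonzero_exponents (@fps_term R) /\
      (forall m : cmonom nat,
        - fps_log1m (fps_var_sum R[i]) m =
        - fps_sum nonzero_exponents (@fps_term R) m)
    & (* the identity of functions and its convergence *)
      forall e : R, 0 < e ->
        [/\ forall x : nat -> R[i], region e x ->
              abs_cvg nonzero_exponents (term x) /\
              (exists2 s : R[i], has_sum nonzero_exponents (term x) s &
                - log1m (series_sum x) = - s),
            abs_unif_cvg_deg (@mdeg nat) nonzero_exponents (region e) (@term R)
          & forall S : set (nat -> R[i]), S `<=` region e ->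
              abs_unif_cvg [set: nat] S (fun x i => x i) ->
              abs_unif_cvg nonzero_exponents S (@term R)]].
Proof.
split; [exact: coef_full_orbits|exact: formal_identity|exact: analytic_identity].
Qed.
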